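(* Let $k$ be a perfect field of characteristic $p>0$, let $F\in k\llbracket X,Y\rrbracket$ be a (one-dimensional) formal group law over $k$, and let $W$ be a $k$-scheme such that the automorphism functor $A_{W/k}$ is representable by a linear algebraic group over $k$. If there is a non-trivial $F$-derivation on $W$, then $\mathrm{ht}(F)=1$ or $\mathrm{ht}(F)=\infty$.
   Context: A formal group law over $k$ is a power series $F\in k\llbracket X,Y\rrbracket$ with $F(X,0)=X=F(0,X)$ and $F(F(X,Y),Z)=F(X,F(Y,Z))$. Height: let $[p]_F(X)\in k\llbracket X\rrbracket$ be the $p$-fold $F$-sum of $X$ with itself. If $[p]_F=0$, then $\mathrm{ht}(F)=\infty$; otherwise $\mathrm{ht}(F)$ is the unique integer $h\geq 1$ such that $[p]_F(X)=g(X^{p^h})$ with $g\in k\llbracket X\rrbracket$, $g(0)=0$, $g'(0)\neq 0$. Automorphism functor: $A_{W/k}$ is the functor from $k$-schemes to groups given by $A_{W/k}(T)=\mathrm{Aut}_T(W\times_k T)$. $F$-derivations on a $k$-algebra: for a commutative $k$-algebra $R$, an $F$-derivation on $R$ (over $k$) is a sequence $(\partial_n:R\to R)_{n\in\mathbb{N}}$ such that $\partial_0=\mathrm{id}_R$, the map $R\to R\llbracket X\rrbracket$, $r\mapsto\sum_n\partial_n(r)X^n$, is a $k$-algebra homomorphism (i.e. $(\partial_n)$ is a Hasse-Schmidt derivation with $\partial_n(k)=0$ for $n>0$), and for every $r\in R$ $$\sum_{i,j\ge 0}\partial_i(\partial_j(r))X^iY^j=\sum_{n\ge 0}\partial_n(r)F(X,Y)^n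 .$$ $F$-derivations on a scheme: for an integer $m>0$, let $F[m]$ be the image of $F$ in $k[X,Y]/(X^{p^m},Y^{p^m})$, and let $G_{F[m]}$ be the finite $k$-group scheme $\mathrm{Spec}(k[X]/(X^{p^m}))$ with group law given by $F[m]$. For $l\le m$, $G_{F[l]}$ is naturally a closed subgroup scheme of $G_{F[m]}$. An $F$-derivation on a $k$-scheme $W$ is a system, for $m>0$, of $k$-group scheme actions of $G_{F[m]}$ on $W$ that are compatible under these inclusions (equivalently, an $F$-derivation on the structure sheaf of $W$; for $W=\mathrm{Spec}(R)$ this is the same as an $F$-derivation on $R$). It is non-trivial if not all of these actions are trivial (equivalently, $\partial_n\neq 0$ for some $n>0$). *)

(* Defs.v *)
From HB Require Import structures.
From mathcomp Require Import all_boot all_order all_algebra.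
From mathcomp Require Import mpoly.

Set Implicit Arguments.
Unset Strict Implicit.
Unset Printing Implicit Defensive.

Import GRing.Theory.
Local Open Scope ring_scope.

#[local] Obligation Tactic := idtac.

(** * Formal power series and formal group laws *)

(* k[[X_1, ..., X_n]], as families of coefficients. *)
Definition pseries (k : fieldType) (n : nat) : Type := 'X_{1..n} -> k.

Definition ps_of_mpoly (k : fieldType) n (q : {mpoly k[n]}) : pseries k n :=
  fun m => q@_m.

Definition ps_trunc (k : fieldType) n (d : nat) (f : pseries k n) :
    {mpoly k[n]} :=
  \sum_(m : 'X_{1..n < d}) f m *: 'X_[m].

(* f(g_1, ..., g_n), for g_i without constant term.  Since g_i has no constant
   term, only the terms of degree at most |m| of f and of the g_i contribute to
   the coefficient at m, so that this coefficient is computed by polynomial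
   composition.  (Not meaningful if some g_i has a constant term.) *)
Definition ps_comp (k : fieldType) n r (f : pseries k n)
    (g : n.-tuple (pseries k r)) : pseries k r :=
  fun m => (ps_trunc (mdeg m).+1 f \mPo
              [tuple ps_trunc (mdeg m).+1 (tnth g i) | i < n])@_m.

Definition ps_var (k : fieldType) n (i : 'I_n) : pseries k n :=
  ps_of_mpoly 'X_i.

Section FormalGroupLaw.
Variable k : fieldType.

Local Notation psT := (ps_var k (ord0 : 'I_1)).
Local Notation psO := (ps_of_mpoly (0 : {mpoly k[1]})).
Local Notation psX := (ps_var k (inord 0 : 'I_3)).
Local Notation psY := (ps_var k (inord 1 : 'I_3)).
Local Notation psZ := (ps_var k (inord 2 : 'I_3)).

Record formal_group_law := FormalGroupLaw {
  fgl_series :> pseries k 2;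
  fgl_right0 : ps_comp fgl_series [tuple psT; psO] =1 psT;
  fgl_left0 : ps_comp fgl_series [tuple psO; psT] =1 psT;
  fgl_assoc :
    ps_comp fgl_series [tuple ps_comp fgl_series [tuple psX; psY]; psZ] =1
    ps_comp fgl_series [tuple psX; ps_comp fgl_series [tuple psY; psZ]]
}.

(* [n]_F(X) *)
Fixpoint fgl_nmul (F : formal_group_law) (n : nat) : pseries k 1 :=
  if n is n'.+1 then ps_comp F [tuple psT; fgl_nmul F n'] else psO.

(* ht(F) = h, where None stands for infinity *)
Definition fgl_height (p : nat) (F : formal_group_law) (h : option nat) : Prop :=
  match h with
  | None => fgl_nmul F p =1 psO
  | Some h =>
      (1 <= h)%N /\
      exists g : pseries k 1,
        [/\ g 0%MM = 0, g U_(ord0)%MM != 0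
          & fgl_nmul F p =1
            ps_comp g [tuple ps_of_mpoly ('X_ord0 ^+ (p ^ h)%N)]]
  end.

End FormalGroupLaw.

(** * Schemes over k as functors of points *)

(* Schemes are taken in the sense of Demazure and Gabriel: a k-scheme is a
   functor from commutative k-algebras to sets which is a sheaf for the Zariski
   topology and is covered by affine open subfunctors.  In [comAlgType k] the
   zero algebra is excluded; this loses nothing, because the zero algebra is
   covered by the empty family and so every Zariski sheaf has exactly one point
   over it. *)

Record kfunctor (k : fieldType) := KFunctor {
  kpts :> comAlgType k -> Type;
  kmap : forall A B : comAlgType k, {lrmorphism A -> B} -> kpts A -> kpts B;
  kmap_id : forall (A : comAlgType k) (f : {lrmorphism A -> A}),
    f =1 id -> kmap f =1 id;
  kmap_comp : forall (A B C : comAlgType k) (f : {lrmorphism A -> B})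
      (g : {lrmorphism B -> C}) (h : {lrmorphism A -> C}),
    h =1 g \o f -> kmap h =1 kmap g \o kmap f
}.

Record ktrans (k : fieldType) (X Y : kfunctor k) := KTrans {
  ktapp :> forall R : comAlgType k, X R -> Y R;
  ktnat : forall (R S : comAlgType k) (f : {lrmorphism R -> S}) (x : X R),
    ktapp (kmap f x) = kmap f (ktapp x)
}.

Definition kteq (k : fieldType) (X Y : kfunctor k) (f g : ktrans X Y) : Prop :=
  forall R : comAlgType k, f R =1 g R.

Program Definition ktcomp (k : fieldType) (X Y Z : kfunctor k)
    (g : ktrans Y Z) (f : ktrans X Y) : ktrans X Z :=
  {| ktapp := fun R x => g R (f R x) |}.
Next Obligation. by move=> * /=; rewrite !ktnat. Qed.

Program Definition kprod (k : fieldType) (X Y : kfunctor k) : kfunctor k :=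
  {| kpts := fun R => (X R * Y R)%type;
     kmap := fun A B f z => (kmap f z.1, kmap f z.2) |}.
Next Obligation. by move=> k X Y A f f1 [x y] /=; rewrite !kmap_id. Qed.
Next Obligation.
by move=> k X Y A B C f g h hE [x y] /=; rewrite !(kmap_comp hE).
Qed.

Section Scheme.
Variable k : fieldType.
Implicit Types (X : kfunctor k) (R S A : comAlgType k).

(* phi exhibits S as the localization R[1/f] *)
Definition is_localization R S (f : R) (phi : {lrmorphism R -> S}) : Prop :=
  [/\ exists u, phi f * u = 1,
      forall s, exists n r, s * phi f ^+ n = phi r
    & forall r, phi r = 0 -> exists n, f ^+ n * r = 0].

(* Compatibility is tested over all k-algebras T under S i and S j, rather than
   only over the localization of R at f i * f j (which is their pushout, and
   which may vanish). *)
Definition zariski_sheaf X : Prop :=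
  forall R n (f : 'I_n -> R) (S : 'I_n -> comAlgType k)
    (phi : forall i, {lrmorphism R -> S i}),
    (exists c : 'I_n -> R, \sum_i c i * f i = 1) ->
    (forall i, is_localization (f i) (phi i)) ->
  forall x : forall i, X (S i),
    (forall i j (T : comAlgType k)
       (u : {lrmorphism S i -> T}) (v : {lrmorphism S j -> T}),
       u \o phi i =1 v \o phi j -> kmap u (x i) = kmap v (x j)) ->
  exists! y : X R, forall i, kmap (phi i) y = x i.

Record subfunctor X := SubFunctor {
  sub_pts :> forall R, X R -> Prop;
  sub_stable : forall R S (f : {lrmorphism R -> S}) (x : X R),
    sub_pts x -> sub_pts (kmap f x)
}.

Definition sub_full X : subfunctor X :=
  @SubFunctor X (fun _ _ => True) (fun _ _ _ _ _ => I).

(* For every x : Spec R -> X, the inverse image of U is the open subscheme D(E)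
   of Spec R, complementary to the zero locus of a subset E of R. *)
Definition sub_open X (U : subfunctor X) : Prop :=
  forall R (x : X R), exists E : R -> Prop,
  forall S (phi : {lrmorphism R -> S}),
    U S (kmap phi x) <->
    exists n (a : 'I_n -> R) (c : 'I_n -> S),
      (forall i, E (a i)) /\ \sum_i c i * phi (a i) = 1.

(* U is isomorphic to Spec A, with universal point u *)
Definition sub_Spec X (U : subfunctor X) A (u : X A) : Prop :=
  U A u /\
  forall R (x : X R), U R x ->
  exists phi : {lrmorphism A -> R},
    kmap phi u = x /\ forall psi : {lrmorphism A -> R}, kmap psi u = x -> psi =1 phi.

Definition sub_affine X (U : subfunctor X) : Prop :=
  exists A (u : X A), sub_Spec U u.

Definition is_field_alg R : Prop :=
  forall x : R, x != 0 -> exists y, x * y = 1.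

Definition is_scheme X : Prop :=
  zariski_sheaf X /\
  forall K, is_field_alg K -> forall x : X K,
  exists U : subfunctor X, [/\ sub_open U, sub_affine U & U K x].

End Scheme.

Record kscheme (k : fieldType) := KScheme {
  ksch_functor :> kfunctor k;
  ksch_scheme : is_scheme ksch_functor
}.

(** * Group schemes and linear algebraic groups *)

Record kgroup (k : fieldType) := KGroup {
  kgrp_scheme :> kscheme k;
  kgrp_one : forall R, kgrp_scheme R;
  kgrp_mul : forall R, kgrp_scheme R -> kgrp_scheme R -> kgrp_scheme R;
  kgrp_inv : forall R, kgrp_scheme R -> kgrp_scheme R;
  kgrp_one_nat : forall (R S : comAlgType k) (f : {lrmorphism R -> S}),
    kmap f (kgrp_one R) = kgrp_one S;
  kgrp_mul_nat : forall (R S : comAlgType k) (f : {lrmorphism R -> S}),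
    {morph @kmap k kgrp_scheme R S f : x y / kgrp_mul x y};
  kgrp_inv_nat : forall (R S : comAlgType k) (f : {lrmorphism R -> S}),
    {morph @kmap k kgrp_scheme R S f : x / kgrp_inv x};
  kgrp_mulA : forall R, associative (@kgrp_mul R);
  kgrp_mul1 : forall R, left_id (kgrp_one R) (@kgrp_mul R);
  kgrp_mulV : forall R, left_inverse (kgrp_one R) (@kgrp_inv R) (@kgrp_mul R)
}.

Definition alg_finite_type (k : fieldType) (A : comAlgType k) : Prop :=
  exists n (v : 'I_n -> A), forall a : A,
  exists q : {mpoly k[n]}, a = mmap (in_alg A) v q.

(* Affine group schemes of finite type; no smoothness is required. *)
Definition linear_algebraic (k : fieldType) (G : kgroup k) : Prop :=
  exists (A : comAlgType k) (u : G A),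
    sub_Spec (sub_full G) u /\ alg_finite_type A.

(** * The automorphism functor *)

Section AutFunctor.
Variables (k : fieldType) (W : kfunctor k).

(* Aut_T (W x T) *)
Record autT (T : kfunctor k) := AutT {
  aut_fun : ktrans (kprod W T) (kprod W T);
  aut_inv : ktrans (kprod W T) (kprod W T);
  aut_funK : forall R, cancel (aut_fun R) (aut_inv R);
  aut_invK : forall R, cancel (aut_inv R) (aut_fun R);
  aut_over : forall R z, (aut_fun R z).2 = z.2
}.

Definition aut_eq T (a b : autT T) : Prop := kteq (aut_fun a) (aut_fun b).

Program Definition aut_mul T (a b : autT T) : autT T :=
  {| aut_fun := ktcomp (aut_fun a) (aut_fun b);
     aut_inv := ktcomp (aut_inv b) (aut_inv a) |}.
Next Obligation. by move=> T a b R z /=; rewrite !aut_funK. Qed.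
Next Obligation. by move=> T a b R z /=; rewrite !aut_invK. Qed.
Next Obligation. by move=> T a b R z /=; rewrite !aut_over. Qed.

Lemma aut_inv_over T (a : autT T) R z : (aut_inv a R z).2 = z.2.
Proof. by rewrite -{2}(aut_invK a z) aut_over. Qed.

Program Definition ktpull T T' (h : ktrans T' T)
    (f : ktrans (kprod W T) (kprod W T)) : ktrans (kprod W T') (kprod W T') :=
  {| ktapp := fun R z => ((f R (z.1, h R z.2)).1, z.2) |}.
Next Obligation.
move=> T T' h f R S phi [w t] /=; rewrite ktnat.
by rewrite -[(kmap phi w, _)]/(@kmap _ (kprod W T) _ _ phi (w, h R t)) ktnat.
Qed.

(* A(h) : Aut_T (W x T) -> Aut_T' (W x T'), base change along h : T' -> T *)
Program Definition aut_pull T T' (h : ktrans T' T) (a : autT T) : autT T' :=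
  {| aut_fun := ktpull h (aut_fun a); aut_inv := ktpull h (aut_inv a) |}.
Next Obligation.
move=> T T' h a R [w t] /=.
have := aut_over a (w, h R t); have := aut_funK a (w, h R t).
by case: (aut_fun a R _) => w' t' /= + <- => ->.
Qed.
Next Obligation.
move=> T T' h a R [w t] /=.
have := aut_inv_over a (w, h R t); have := aut_invK a (w, h R t).
by case: (aut_inv a R _) => w' t' /= + <- => ->.
Qed.
Next Obligation. by []. Qed.

End AutFunctor.

(* Product in the group Hom(T, G) *)
Program Definition khom_mul (k : fieldType) (T : kfunctor k) (G : kgroup k)
    (f g : ktrans T G) : ktrans T G :=
  {| ktapp := fun R t => kgrp_mul (f R t) (g R t) |}.
Next Obligation. by move=> * /=; rewrite !ktnat kgrp_mul_nat. Qed.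

(* The functor T |-> Aut_T (W x T) from k-schemes to groups is isomorphic to
   Hom(-, G). *)
Definition aut_represented (k : fieldType) (W : kscheme k) (G : kgroup k) :
    Prop :=
  exists Phi : forall T : kscheme k, ktrans T G -> autT W T,
  [/\ forall (T : kscheme k) (f g : ktrans T G),
        aut_eq (Phi T f) (Phi T g) <-> kteq f g,
      forall (T : kscheme k) (a : autT W T),
        exists f : ktrans T G, aut_eq (Phi T f) a,
      forall (T : kscheme k) (f g : ktrans T G),
        aut_eq (Phi T (khom_mul f g)) (aut_mul (Phi T f) (Phi T g))
    & forall (T T' : kscheme k) (h : ktrans T' T) (f : ktrans T G),
        aut_eq (Phi T' (ktcomp f h)) (aut_pull h (Phi T f))].

(** * The group schemes G_F[m] and F-derivations *)

Section FDerivation.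
Variables (k : fieldType) (p : nat).
Hypothesis pk : p \in [pchar k].
Variable F : formal_group_law k.

(* Functor of points of Spec (k[X] / (X^(p^m))): a k-algebra morphism
   k[X] / (X^(p^m)) -> R is determined by the image of X. *)
Program Definition GF (m : nat) : kfunctor k :=
  {| kpts := fun R => {x : R | x ^+ (p ^ m)%N == 0};
     kmap := fun R S f x => exist _ (f (val x)) _ |}.
Next Obligation.
by move=> m R S f [x /= /eqP x0]; rewrite -rmorphXn x0 rmorph0.
Qed.
Next Obligation. by move=> m A f f1 x; apply: val_inj; rewrite /= f1. Qed.
Next Obligation. by move=> m A B C f g h hE x; apply: val_inj; rewrite /= hE. Qed.

(* The polynomial F[m](x, y) *)
Definition fgl_trunc (m : nat) (R : comAlgType k) (x y : R) : R :=
  \sum_(i < p ^ m) \sum_(j < p ^ m)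
    fgl_series F [multinom [tuple (i : nat); (j : nat)]] *: (x ^+ i * y ^+ j).

Lemma fgl_const0 : fgl_series F [multinom [tuple 0%N; 0%N]] = 0.
Proof.
have -> : [multinom [tuple 0%N; 0%N]] = 0%MM :> 'X_{1..2}.
  by apply/mnmP => i; rewrite mnm0E; case: i => [[|[|i]] ?].
have := fgl_right0 F 0%MM.
rewrite /ps_comp /ps_var /ps_of_mpoly mcoeffX mdeg0 /ps_trunc.
have lt01 : (mdeg (0%MM : 'X_{1..2}) < 1)%N by rewrite mdeg0.
rewrite (bigD1 (BMultinom lt01)) //=.
rewrite big1 ?addr0 => [|[m /= m1] /eqP mN0]; last first.
  by case: mN0; apply: val_inj; apply/eqP; rewrite -mdeg_eq0 -leqn0 -ltnS.
rewrite mpolyX0 comp_mpolyZ comp_mpoly1 mcoeffZ mcoeff1 eqxx mulr1 => ->.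
by rewrite (_ : (_ == _) = false) //; apply/negbTE; rewrite mnm1_eq0.
Qed.

Lemma fgl_trunc_nilp m (R : comAlgType k) (x y : R) :
  x ^+ (p ^ m)%N == 0 -> y ^+ (p ^ m)%N == 0 ->
  fgl_trunc m x y ^+ (p ^ m)%N == 0.
Proof.
have pR : p \in [pchar R] by rewrite pchar_lalg.
have q_gt0 : (0 < p ^ m)%N by rewrite expn_gt0 prime_gt0 ?(pcharf_prime pk).
have addq (a b : R) : (a + b) ^+ (p ^ m)%N = a ^+ (p ^ m)%N + b ^+ (p ^ m)%N.
  by apply: exprDn_pchar; rewrite pnatX (eq_pnat _ (pcharf_eq pR)) pnat_id
       ?(pcharf_prime pk).
have zq : (0 : R) ^+ (p ^ m)%N = 0 by rewrite expr0n (gtn_eqF q_gt0).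
move=> /eqP x0 /eqP y0; apply/eqP; rewrite /fgl_trunc.
rewrite (big_morph (fun a : R => a ^+ (p ^ m)%N) addq zq) big1 // => i _.
rewrite (big_morph (fun a : R => a ^+ (p ^ m)%N) addq zq) big1 // => j _.
rewrite exprZn exprMn -!exprM ![(_ * p ^ m)%N]mulnC !exprM x0 y0 !expr0n.
case: (nat_of_ord i) => [|i']; last by rewrite mul0r scaler0.
case: (nat_of_ord j) => [|j']; last by rewrite mulr0 scaler0.
by rewrite fgl_const0 expr0n (gtn_eqF q_gt0) scale0r.
Qed.

Lemma GF_one_subproof m (R : comAlgType k) : (0 : R) ^+ (p ^ m)%N == 0.
Proof.
by rewrite expr0n (gtn_eqF _) // expn_gt0 prime_gt0 ?(pcharf_prime pk).
Qed.

Definition GF_one m R : GF m R := exist _ 0 (GF_one_subproof m R).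

Definition GF_mul m R (x y : GF m R) : GF m R :=
  exist _ (fgl_trunc m (val x) (val y)) (fgl_trunc_nilp (valP x) (valP y)).

Lemma GF_incl_subproof l m (R : comAlgType k) (x : R) :
  (l <= m)%N -> x ^+ (p ^ l)%N == 0 -> x ^+ (p ^ m)%N == 0.
Proof.
by move=> lm /eqP x0; rewrite -(subnKC lm) expnD exprM x0 expr0n
  (gtn_eqF _) // expn_gt0 prime_gt0 ?(pcharf_prime pk).
Qed.

(* The closed immersion of G_F[l] into G_F[m] for l <= m *)
Definition GF_incl l m (lm : (l <= m)%N) R (x : GF l R) : GF m R :=
  exist _ (val x) (GF_incl_subproof lm (valP x)).

(* Only the components with m > 0 are constrained or used. *)
Record F_derivation (W : kfunctor k) := FDerivation {
  fder_act :> forall m : nat, ktrans (kprod (GF m) W) W;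
  fder_one : forall m R (w : W R), (0 < m)%N ->
    fder_act m R (GF_one m R, w) = w;
  fder_mul : forall m R (x y : GF m R) (w : W R), (0 < m)%N ->
    fder_act m R (GF_mul x y, w) = fder_act m R (x, fder_act m R (y, w));
  fder_compat : forall l m (lm : (l <= m)%N) R (x : GF l R) (w : W R),
    (0 < l)%N -> fder_act m R (GF_incl lm x, w) = fder_act l R (x, w)
}.

Definition F_derivation_nontrivial (W : kfunctor k) (D : F_derivation W) : Prop :=
  exists m R (x : GF m R) (w : W R), (0 < m)%N /\ D m R (x, w) <> w.

End FDerivation.

(* Main.v *)
Require Import Defs.
From HB Require Import structures.
From mathcomp Require Import all_boot all_order all_algebra.
From mathcomp Require Import mpoly.
From mathcomp Require Import boolp.
From mathcomp Require Import zify ring.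

Set Implicit Arguments.
Unset Strict Implicit.
Unset Printing Implicit Defensive.

Import GRing.Theory.
Local Open Scope ring_scope.

(** An F-derivation on W is a compatible system of homomorphisms G_F[m] -> G, where
    G represents the automorphism functor.  Through the regular representation of
    the algebraic group G it yields a nontrivial power series M(X) with matrix
    coefficients such that M(X) M(Y) = M(F(X, Y)); in particular
    M([p]_F(X)) = M(X)^p.  Let s(X) be a coefficient of the characteristic
    polynomial of M(X).  In characteristic p the coefficients of the characteristic
    polynomial of M^p are the p-th powers of those of M, so s([p]_F(X)) = s(X)^p.
    If some s is not constant, comparing orders shows that [p]_F has order p, and
    differentiating (after extracting p-th roots from s, k being perfect) shows that
    [p]_F is a series in X^p: the height is 1.  If all of them are constant, M(X) is
    unipotent, so M(X)^(p^N) = M([p^N]_F(X)) = 1 for some N, which forces [p]_F = 0.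
    Power series are always evaluated at nilpotent elements of k-algebras, so that
    only truncated polynomial algebras are needed. *)

(** * Truncated polynomial algebras *)

(** Representability only speaks of schemes T, so it is applied to a single test scheme at each
    level, G_F[e] x G_F[e]. No embedding of G into a general linear group is chosen. Instead, take a
    function on G whose pullback lam(X) is not constant. Its comultiplication is a finite sum of
    tensors, so lam(F(X, Y)) = sum_l r_l(X) s_l(Y) has finite rank. Let e_i be dual to X^i, with e_i
    e_j = sum_n c_nij e_n, where c_nij is the coefficient of X^i Y^j in F^n. This algebra acts on
    its finite-dimensional quotient by the kernel of the form lam(e_i e_j), and the matrices of the
    e_n are the coefficients of M(X). Truncation is always at q = p^e: raising to the q-th power is
    additive in characteristic p, so x^q = y^q = 0 implies F(x, y)^q = 0. In the unipotent case the
    last implication is again about orders: if [p]_F had finite order t, its N-th iterate would have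
    order t^N, and substituting it in the nonconstant series M(X) could not give 1. *)

Section Quotient.
Variables (k : fieldType) (B : comNzRingType) (i : {rmorphism k -> B}).
Variables (I : B -> Prop).
Hypotheses (I0 : I 0) (I1 : ~ I 1).
Hypothesis ID : forall a u v, I u -> I v -> I (a * u + v).

Definition quotient_pred (b : B) : bool := `[< I b >].
Let S := quotient_pred.
Let S_closed : idealr_closed S.
Proof.
split; rewrite ?unfold_in /S /quotient_pred; first exact/asboolP.
  by apply/negP => /asboolP.
by move=> a u v; rewrite !unfold_in /S /quotient_pred => /asboolP Iu /asboolP Iv; apply/asboolP/ID.
Qed.
Let SI : idealr B := HB.pack S (isIdealr.Build B S S_closed).
Let Q0 := {ideal_quot SI}.
HB.instance Definition _ := GRing.ComNzRing.on Q0.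
Let pi : B -> Q0 := \pi_Q0%qT.
HB.instance Definition _ := GRing.RMorphism.on pi.
Let sc (a : k) (x : Q0) := pi (i a) * x.
Let scA a b v : sc a (sc b v) = sc (a * b) v.
Proof. by rewrite /sc mulrA !rmorphM. Qed.
Let sc1 : left_id 1 sc.
Proof. by move=> v; rewrite /sc !rmorph1 mul1r. Qed.
Let scDr : right_distributive sc +%R.
Proof. by move=> a u v; rewrite /sc mulrDr. Qed.
Let scDl v : {morph sc^~ v : a b / a + b}.
Proof. by move=> a b; rewrite /sc !rmorphD mulrDl. Qed.
HB.instance Definition _ := GRing.Zmodule_isLmodule.Build k Q0 scA sc1 scDr scDl.
Let scAl (a : k) (u v : Q0) : a *: (u * v) = (a *: u) * v.
Proof. by rewrite /GRing.scale /= /sc mulrA. Qed.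
HB.instance Definition _ := GRing.Lmodule_isLalgebra.Build k Q0 scAl.
HB.instance Definition _ := GRing.Lalgebra_isComAlgebra.Build k Q0.

(** Truncated polynomial algebras, localizations and tensor products are all obtained from this. The
    ideal is a mere [Prop], made boolean classically; [I1] keeps the quotient nonzero, as
    [comAlgType] requires. *)
Lemma quotient_algebra : exists (Q : comAlgType k) (pi : {rmorphism B -> Q}),
  [/\ forall z, exists b, z = pi b, forall b, pi b = 0 <-> I b
    & forall a : k, pi (i a) = a%:A].
Proof.
exists Q0, pi; split=> [z|b|a]; last by rewrite /GRing.scale /= /sc mulr1.
  by exists (repr z); exact: esym (reprK z).
have piE0 : (pi b == pi 0) = `[< I b >].
  by rewrite [LHS]piE Quotient.equivE subr0.
rewrite -(rmorph0 pi); split=> [/eqP|Ib]; first by rewrite piE0 => /asboolP.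
by apply/eqP; rewrite piE0; apply/asboolP.
Qed.

End Quotient.

Lemma lrmorphism_of (k : fieldType) (A B : comAlgType k) (f : A -> B) :
  {morph f : x y / x + y} -> {morph f : x y / x * y} -> f 1 = 1 ->
  (forall (a : k) x, f (a *: x) = a *: f x) ->
  exists phi : {lrmorphism A -> B}, phi =1 f.
Proof.
move=> fD fM f1 fZ.
have fB : zmod_morphism f.
  by move=> x y; rewrite fD -!scaleN1r fZ.
pose fZm := GRing.isZmodMorphism.Build A B f fB.
pose fMm := GRing.isMonoidMorphism.Build A B f (f1, fM).
pose fSm := GRing.isScalable.Build k A B *:%R f fZ.
pose phi : {lrmorphism A -> B} := HB.pack f fZm fMm fSm.
by exists phi.
Qed.

Lemma lrmorphism_in_alg (k : fieldType) (A B : comAlgType k)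
    (phi : {lrmorphism A -> B}) (a : k) : phi a%:A = a%:A.
Proof. by rewrite linearZ rmorph1. Qed.

(** A set-theoretic section [s] of [pi] exists by choice, and [g \o s] does not depend on it because
    [g] kills the kernel of [pi]. *)
Lemma quotient_lift (k : fieldType) (B : comNzRingType) (i : {rmorphism k -> B})
    (Q S : comAlgType k) (pi : {rmorphism B -> Q}) (g : {rmorphism B -> S}) :
  (forall z, exists b, z = pi b) -> (forall a : k, pi (i a) = a%:A) ->
  (forall a : k, g (i a) = a%:A) -> (forall b, pi b = 0 -> g b = 0) ->
  exists Phi : {lrmorphism Q -> S}, forall b, Phi (pi b) = g b.
Proof.
move=> pi_surj pik gk pig.
have [s sE] := choice pi_surj.
have gE b b' : pi b = pi b' -> g b = g b'.
  by move=> e; apply/subr0_eq; rewrite -rmorphB pig // rmorphB e subrr.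
have sK b : g (s (pi b)) = g b by apply: gE; rewrite -sE.
have [|||a x|Phi PhiE] := @lrmorphism_of k Q S (g \o s).
- by move=> x y /=; rewrite [x]sE [y]sE -rmorphD !sK rmorphD.
- by move=> x y /=; rewrite [x]sE [y]sE -rmorphM !sK rmorphM.
- by rewrite /= -(rmorph1 pi) sK rmorph1.
- rewrite /= -[a *: x]mulr_algl [x]sE -pik -rmorphM !sK rmorphM gk.
  by rewrite mulr_algl.
by exists Phi => b; rewrite PhiE /= sK.
Qed.

(* [T] is the algebra R[X] / (X^q), with [C] the inclusion of the constants *)
Record truncated_poly (k : fieldType) (R : comAlgType k) (q : nat)
    (T : comAlgType k) (C : {lrmorphism R -> T}) (X : T) : Prop := TruncatedPoly {
  trunc_nil : X ^+ q = 0;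
  trunc_gen : forall z, exists a : nat -> R, z = \sum_(i < q) C (a i) * X ^+ i;
  trunc_free : forall a : nat -> R, \sum_(i < q) C (a i) * X ^+ i = 0 ->
    forall i, (i < q)%N -> a i = 0;
  trunc_univ : forall (S : comAlgType k) (phi : {lrmorphism R -> S}) (s : S),
    s ^+ q = 0 ->
    exists Phi : {lrmorphism T -> S}, Phi \o C =1 phi /\ Phi X = s
}.

Lemma trunc_inj (k : fieldType) (R : comAlgType k) (q : nat)
    (T : comAlgType k) (C : {lrmorphism R -> T}) (X : T) (a b : nat -> R) :
  truncated_poly q C X ->
  \sum_(i < q) C (a i) * X ^+ i = \sum_(i < q) C (b i) * X ^+ i ->
  forall i, (i < q)%N -> a i = b i.
Proof.
move=> HT e i iq; apply/subr0_eq.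
apply: (trunc_free HT (a := fun i => a i - b i)) iq.
under eq_bigr do rewrite rmorphB mulrBl.
by rewrite sumrB e subrr.
Qed.

Lemma trunc_eq (k : fieldType) (R : comAlgType k) (q : nat)
    (T S : comAlgType k) (C : {lrmorphism R -> T}) (X : T)
    (f g : {lrmorphism T -> S}) :
  truncated_poly q C X -> f \o C =1 g \o C -> f X = g X -> f =1 g.
Proof.
move=> HT eC eX z; have [a ->] := trunc_gen HT z.
rewrite !rmorph_sum; apply: eq_bigr => i _.
by rewrite !rmorphM !rmorphXn /= eX; have /= -> := eC (a i).
Qed.

Lemma truncated_poly_exists (k : fieldType) (R : comAlgType k) (q : nat) :
  (0 < q)%N ->
  exists (T : comAlgType k) (C : {lrmorphism R -> T}) (X : T), truncated_poly q C X.
Proof.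
move=> q_gt0; pose i : {rmorphism k -> {poly R}} := polyC \o in_alg R.
pose I (P : {poly R}) := forall j, (j < q)%N -> P`_j = 0.
have [|||T [pi [pi_surj piI pik]]] := @quotient_algebra k _ i I.
- by move=> j _; rewrite coef0.
- by move=> /(_ 0%N q_gt0)/eqP; rewrite coef1 oner_eq0.
- move=> a u v Iu Iv j jq; rewrite coefD Iv // addr0 coefM big1 // => l _.
  by rewrite Iu ?mulr0 //; exact: leq_ltn_trans (leq_subr _ _) jq.
have [|||a x|C CE] := @lrmorphism_of k R T (pi \o polyC).
- by move=> x y; rewrite /= !rmorphD.
- by move=> x y; rewrite /= !rmorphM.
- by rewrite /= !rmorph1.
- by rewrite /= -[a *: x]mulr_algl rmorphM rmorphM -[pi (_%:A)%:P]/(pi (i a)) pik mulr_algl.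
have sumE (a : nat -> R) :
    \sum_(j < q) C (a j) * pi 'X ^+ j = pi (\poly_(j < q) a j).
  rewrite poly_def rmorph_sum; apply: eq_bigr => j _.
  by rewrite CE /= -mul_polyC rmorphM rmorphXn.
exists T, C, (pi 'X); split=> [|z|a|S phi s sq].
- rewrite -rmorphXn; apply/piI => j jq.
  by rewrite coefXn (ltn_eqF jq).
- have [P ->] := pi_surj z; exists (fun j => P`_j); rewrite sumE.
  apply/subr0_eq; rewrite -rmorphB; apply/piI => j jq.
  by rewrite coefB coef_poly jq subrr.
- rewrite sumE => /piI aI j jq.
  by have := aI j jq; rewrite coef_poly jq.
- pose g : {rmorphism {poly R} -> S} := (horner_eval s) \o (map_poly phi).
  have gE P : g P = \sum_(j < size P) phi P`_j * s ^+ j.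
    rewrite /g /= /horner_eval (@horner_coef_wide _ (size P)) ?size_poly //.
    by apply: eq_bigr => j _; rewrite coef_map.
  have [||Phi PhiE] := quotient_lift pi_surj pik (g := g).
  + by move=> a; rewrite /g /= /horner_eval map_polyC hornerC /= lrmorphism_in_alg.
  + move=> P /piI PI; rewrite gE big1 // => j _.
    have [jq|qj] := ltnP j q; first by rewrite PI // rmorph0 mul0r.
    by rewrite -(subnKC qj) exprD sq mul0r mulr0.
  exists Phi; split=> [a|]; last first.
    by rewrite PhiE /g /= /horner_eval map_polyX hornerX.
  by rewrite /= CE /= PhiE /g /= /horner_eval map_polyC hornerC.
Qed.

Lemma base_lrmorphism (k : fieldType) (R : comAlgType k) :
  exists iota : {lrmorphism (k^o : comAlgType k) -> R}, forall a : k, iota a = a%:A.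
Proof.
have [|||a x|iota iotaE] := @lrmorphism_of k (k^o : comAlgType k) R (in_alg R).
- by move=> x y; rewrite rmorphD.
- by move=> x y; rewrite rmorphM.
- by rewrite rmorph1.
- by rewrite /= scalerA.
by exists iota => a; rewrite iotaE.
Qed.

Lemma lrmorphism_base (k : fieldType) (T : comAlgType k)
  (C : {lrmorphism (k^o : comAlgType k) -> T}) (a : k) : C a = a%:A.
Proof. by rewrite -(rmorph1 C) -linearZ; congr (C _); rewrite /GRing.scale /= mulr1. Qed.

(** * Localization and gluing *)

(* R[X] / (1 - hX), for h not nilpotent *)
Lemma localization_exists (k : fieldType) (R : comAlgType k) (h : R) :
  (forall n, h ^+ n <> 0) ->
  exists (T : comAlgType k) (psi : {lrmorphism R -> T}),
    (exists w, psi h * w = 1) /\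
    (forall r, psi r = 0 -> exists n, h ^+ n * r = 0).
Proof.
move=> hN0; pose i : {rmorphism k -> {poly R}} := polyC \o in_alg R.
pose D : {poly R} := 1 - h *: 'X.
pose I (P : {poly R}) := exists Q, P = D * Q.
have coefDQ r Q : r%:P = D * Q -> exists n, h ^+ n * r = 0.
  (* In r = (1 - hX) Q the coefficients of Q are forced to be those of a geometric series, Q_n = h^n
     r; as Q is a polynomial, they vanish from [size Q] on. *)
  move=> e; exists (size Q).
  have Qn n : Q`_n = h ^+ n * r.
    elim: n => [|n IHn].
      have /(congr1 (fun P : {poly R} => P`_0)) := e.
      rewrite /D mulrBl mul1r -scalerAl coefB coefZ coefXM /= mulr0 subr0 coefC.
      by move=> /= <-; rewrite mul1r.
    have /(congr1 (fun P : {poly R} => P`_n.+1)) := e.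
    rewrite /D mulrBl mul1r -scalerAl coefB coefZ coefXM /= IHn coefC /=.
    by move=> /esym/eqP; rewrite subr_eq0 => /eqP->; rewrite exprS mulrA.
  by rewrite -Qn nth_default.
have [|||T [pi [pi_surj piI pik]]] := @quotient_algebra k _ i I.
- by exists 0; rewrite mulr0.
- by move=> [Q]; rewrite -polyC1 => /coefDQ[n]; rewrite mulr1 => /hN0.
- by move=> a u v [Q ->] [Q' ->]; exists (a * Q + Q'); rewrite mulrDr mulrCA.
have [|||a x|C CE] := @lrmorphism_of k R T (pi \o polyC).
- by move=> x y; rewrite /= !rmorphD.
- by move=> x y; rewrite /= !rmorphM.
- by rewrite /= !rmorph1.
- by rewrite /= -[a *: x]mulr_algl rmorphM rmorphM -[pi (_%:A)%:P]/(pi (i a)) pik mulr_algl.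
exists T, C; split=> [|r].
  exists (pi 'X); rewrite CE /= -rmorphM mul_polyC; apply/esym/subr0_eq.
  by rewrite -(rmorph1 pi) -rmorphB; apply/piI; exists 1; rewrite mulr1.
by rewrite CE /= => /piI[Q /coefDQ].
Qed.

Lemma mulrIX (R : comNzRingType) (a b x y : R) n :
  a * b = 1 -> x * a ^+ n = y * a ^+ n -> x = y.
Proof.
move=> ab e; rewrite -[x]mulr1 -[y]mulr1 -(expr1n _ n) -ab exprMn !mulrA.
by rewrite e.
Qed.

Lemma localization_lift (k : fieldType) (R S T : comAlgType k) (h : R)
    (phi : {lrmorphism R -> S}) (psi : {lrmorphism R -> T}) :
  is_localization h phi -> (exists w, psi h * w = 1) ->
  exists u : {lrmorphism S -> T}, u \o phi =1 psi.
Proof.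
move=> [[c hc] gen ker] [w hw].
(* The lift is built from its graph: [P s t] says that s and t are the same fraction r / h^n, read
   in S and in T. The graph is functional because [psi h] is a unit. *)
pose P s t := exists n r, s * phi h ^+ n = phi r /\ t * psi h ^+ n = psi r.
have kerE r r' : phi r = phi r' -> psi r = psi r'.
  move=> e; have [|n hn] := ker (r - r'); first by rewrite rmorphB /= e subrr.
  apply/subr0_eq/(mulrIX (n := n) hw); rewrite mul0r -rmorphB -rmorphXn -rmorphM.
  by rewrite mulrC hn rmorph0.
have Pex s : exists t, P s t.
  have [n [r e]] := gen s; exists (psi r * w ^+ n), n, r; split=> //.
  by rewrite -mulrA -exprMn [w * _]mulrC hw expr1n mulr1.
have Puniq s t t' : P s t -> P s t' -> t = t'.
  move=> [n [r [e1 e2]]] [n' [r' [e1' e2']]].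
  apply: (mulrIX (n := n + n') hw).
  rewrite {1}exprD mulrA e2 addnC exprD mulrA e2' -!rmorphXn -!rmorphM.
  by apply: kerE; rewrite !rmorphM !rmorphXn /= -e1 -e1'; ring.
have [u uP] := choice Pex.
have uE s t : P s t -> u s = t by apply: Puniq.
have Pphi r : P (phi r) (psi r) by exists 0%N, r; rewrite !expr0 !mulr1.
have [|||a x|U UE] := @lrmorphism_of k S T u.
- move=> x y; apply: uE; have [n [r [e1 e2]]] := uP x; have [n' [r' [e1' e2']]] := uP y.
  exists (n + n')%N, (r * h ^+ n' + r' * h ^+ n).
  rewrite !rmorphD !rmorphM !rmorphXn /= -e1 -e2 -e1' -e2' !exprD.
  by split; ring.
- move=> x y; apply: uE; have [n [r [e1 e2]]] := uP x; have [n' [r' [e1' e2']]] := uP y.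
  exists (n + n')%N, (r * r').
  rewrite !rmorphM /= -e1 -e2 -e1' -e2' !exprD.
  by split; ring.
- by apply: uE; rewrite -(rmorph1 phi) -(rmorph1 psi); exact: Pphi.
- apply: uE; have [n [r [e1 e2]]] := uP x; exists n, (a *: r).
  by rewrite !linearZ /= -e1 -e2 !scalerAl.
by exists U => r; rewrite /= UE; apply: uE.
Qed.

(** The generators are replaced by their N-th powers one at a time, along the list [s]; each
    replacement rests on 1 = A^N + B e, a consequence of A + B = 1. *)
Lemma unit_ideal_exp (R : comNzRingType) n (f c : 'I_n -> R) N :
  \sum_i c i * f i = 1 -> exists d : 'I_n -> R, \sum_i d i * f i ^+ N = 1.
Proof.
move=> cf.
suff H (s : seq 'I_n) : uniq s -> exists d : 'I_n -> R,
    \sum_i d i * (if i \in s then f i ^+ N else f i) = 1.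
  have [d dE] := H _ (enum_uniq 'I_n); exists d; rewrite -[RHS]dE.
  by apply: eq_bigr => i _; rewrite mem_enum.
elim: s => [_|j s IHs /= /andP[js /IHs[d dE]]].
  by exists c; rewrite -[RHS]cf; apply: eq_bigr.
pose g i := if i \in s then f i ^+ N else f i.
pose A := d j * f j; pose B := \sum_(i | i != j) d i * g i.
have AB : A + B = 1.
  by rewrite -[RHS]dE [RHS](bigD1 j) //= (negPf js).
have [e eE] : exists e, 1 = A ^+ N + B * e.
  clearbody A B; clear - AB; elim: N => [|N [e eE]].
    by exists 0; rewrite expr0 mulr0 addr0.
  exists (e * A + 1).
  by rewrite -{1}AB -{1}[A]mul1r {1}eE exprS; ring.
exists (fun i => if i == j then d j ^+ N else d i * e).
rewrite (bigD1 j) //= eqxx mem_head -exprMn -/A eE; congr (_ + _).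
rewrite /B mulr_suml; apply: eq_bigr => i ij.
by rewrite (negPf ij) inE (negPf ij) /= -/(g i); ring.
Qed.

Section Gluing.
Variables (k : fieldType) (R : comAlgType k) (n : nat) (f : 'I_n -> R).
Variables (S : 'I_n -> comAlgType k) (phi : forall i, {lrmorphism R -> S i}).
Hypothesis fE : exists c : 'I_n -> R, \sum_i c i * f i = 1.
Hypothesis floc : forall i, is_localization (f i) (phi i).

Lemma glue_uniq (y y' : R) : (forall i, phi i y = phi i y') -> y = y'.
Proof.
move=> e; apply/subr0_eq.
have H i : exists m, f i ^+ m * (y - y') = 0.
  by have [_ _] := floc i; apply; rewrite rmorphB /= e subrr.
have [m mP] := choice H; have [c cf] := fE.
have [d dE] := unit_ideal_exp (\max_i m i) cf.
rewrite -[_ - _]mul1r -dE mulr_suml big1 // => i _.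
by rewrite -(subnK (leq_bigmax i)) exprD -!mulrA mP !mulr0.
Qed.

Lemma glue (x : forall i, S i) :
  (forall i j (T : comAlgType k)
     (u : {lrmorphism S i -> T}) (v : {lrmorphism S j -> T}),
     u \o phi i =1 v \o phi j -> u (x i) = v (x j)) ->
  exists y : R, forall i, phi i y = x i.
Proof.
move=> xT.
have gen i : exists z : nat * R, x i * phi i (f i) ^+ z.1 = phi i z.2.
  by have [_ /(_ (x i))[a [r e]] _] := floc i; exists (a, r).
have [z zE] := choice gen; pose a := \max_i (z i).1.
pose r i := (z i).2 * f i ^+ (a - (z i).1).
have rE i : x i * phi i (f i) ^+ a = phi i (r i).
  by rewrite rmorphM /= -zE -mulrA rmorphXn -exprD subnKC ?leq_bigmax.
clearbody r.
have compat ij : exists b,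
    (f ij.1 * f ij.2) ^+ b * (f ij.2 ^+ a * r ij.1 - f ij.1 ^+ a * r ij.2) = 0.
  case: ij => i j /=.
  (* If f_i f_j is nilpotent, the overlap would be the zero algebra, which is not a [comAlgType];
     the wanted identity is then trivial for a large power b. *)
  have [hN|[b hb]] : (forall b, (f i * f j) ^+ b <> 0) \/
      exists b, (f i * f j) ^+ b = 0.
  - case: (pselect (exists b, (f i * f j) ^+ b = 0)) => H; first by right.
    by left=> b hb; apply: H; exists b.
  - have [T [psi [[w hw] ker]]] := localization_exists hN.
    have [|u uE] := localization_lift (floc i) (psi := psi).
      by exists (psi (f j) * w); rewrite mulrA -rmorphM.
    have [|v vE] := localization_lift (floc j) (psi := psi).
      by exists (psi (f i) * w); rewrite mulrA -rmorphM [f j * _]mulrC.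
    have uv : u (x i) = v (x j) by apply: xT => s; rewrite uE vE.
    apply: ker; rewrite rmorphB !rmorphM !rmorphXn /=.
    rewrite -[psi (r i)]uE -[psi (r j)]vE /= -!rE !rmorphM !rmorphXn /= uv.
    have /= -> := uE (f i); have /= -> := vE (f j).
    by ring.
  - by exists b; rewrite hb mul0r.
have [b' b'E] := choice compat; pose b := \max_ij b' ij.
have bE i j : f j ^+ (a + b) * (f i ^+ b * r i) = f i ^+ (a + b) * (f j ^+ b * r j).
  apply/subr0_eq.
  rewrite -[RHS](mulr0 ((f i * f j) ^+ (b - b' (i, j)))) -(b'E (i, j)) [RHS]mulrA.
  by rewrite -exprD subnK ?leq_bigmax //= exprMn !exprD; ring.
have [c cf] := fE; have [d dE] := unit_ideal_exp (a + b) cf.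
(* A partition of unity: by [bE] the numerators agree up to powers of the f_i, and the weights d_j
   f_j^(a + b) sum to 1. *)
exists (\sum_j d j * (f j ^+ b * r j)) => i.
have [[w hw] _ _] := floc i.
apply: (mulrIX (n := a + b) hw).
rewrite [in RHS]exprD [RHS]mulrA rE -!(rmorphXn (phi i)) -!(rmorphM (phi i)); congr (phi i _).
rewrite [RHS]mulrC -[RHS]mul1r -dE !mulr_suml.
by apply: eq_bigr => j _; rewrite -!mulrA bE; ring.
Qed.

End Gluing.

(** * Evaluation of power series at nilpotents *)

Lemma mcoeff_ps_trunc (k : fieldType) n d (f : pseries k n) m :
  (ps_trunc d f)@_m = if (mdeg m < d)%N then f m else 0.
Proof.
rewrite /ps_trunc; case: ltnP => [/mcoeff_mpoly->//|dm].
rewrite raddf_sum big1 //= => i _; rewrite mcoeffZ mcoeffX.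
by case: eqP => [im|_]; [rewrite -im leqNgt bmdeg in dm | rewrite mulr0].
Qed.

Lemma mmap_eq0 (k : fieldType) n (R : comAlgType k) (v : 'I_n -> R)
    (P : {mpoly k[n]}) :
  (forall m : 'X_{1..n}, P@_m != 0 -> \prod_i v i ^+ m i = 0) ->
  mmap (in_alg R) v P = 0.
Proof.
move=> H; rewrite /mmap big_seq big1 // => m; rewrite mcoeff_msupp => /H.
by rewrite /mmap1 => ->; rewrite mulr0.
Qed.

Lemma mmap_eq (k : fieldType) n (R : comAlgType k) (v : 'I_n -> R)
    (P Q : {mpoly k[n]}) :
  (forall m : 'X_{1..n}, P@_m != Q@_m -> \prod_i v i ^+ m i = 0) ->
  mmap (in_alg R) v P = mmap (in_alg R) v Q.
Proof.
move=> H; apply/subr0_eq; rewrite -mmapB; apply: mmap_eq0 => m.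
by rewrite mcoeffB subr_eq0; apply: H.
Qed.

Lemma rmorph_comp_mpoly (k : fieldType) n r (R : comAlgType k)
    (phi : {rmorphism {mpoly k[r]} -> R}) (P : {mpoly k[n]})
    (g : n.-tuple {mpoly k[r]}) :
  (forall a, phi a%:MP = a%:A) ->
  phi (P \mPo g) = mmap (in_alg R) (fun i => phi (tnth g i)) P.
Proof.
move=> phik; rewrite /comp_mpoly /mmap rmorph_sum; apply: eq_bigr => m _.
rewrite rmorphM phik /mmap1 rmorph_prod; congr (_ * _).
by apply: eq_bigr => i _; rewrite rmorphXn.
Qed.

Definition order_ge (k : fieldType) n d (P : {mpoly k[n]}) : Prop :=
  forall m, (mdeg m < d)%N -> P@_m = 0.

Lemma order_geM (k : fieldType) n a b (P Q : {mpoly k[n]}) :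
  order_ge a P -> order_ge b Q -> order_ge (a + b) (P * Q).
Proof.
move=> Pa Qb m mab; rewrite mcoeffM big1 // => -[m1 m2] /= /eqP mE.
have [m1a|am1] := ltnP (mdeg m1) a; first by rewrite Pa ?mul0r.
rewrite Qb ?mulr0 // -(ltn_add2l a); apply: leq_ltn_trans mab.
by rewrite [in leqRHS]mE mdegD leq_add2r.
Qed.

Lemma order_ge_monomial (k : fieldType) n r (g : 'I_n -> {mpoly k[r]})
    (m : 'X_{1..n}) :
  (forall i, order_ge 1 (g i)) -> order_ge (mdeg m) (\prod_i g i ^+ m i).
Proof.
move=> g1; rewrite mdegE; elim/big_ind2: _ => [|a P b Q|i _]; first by [].
  exact: order_geM.
elim: (m i) => [|e IHe]; first by [].
by rewrite exprS -add1n; apply: order_geM.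
Qed.

(* Composing modulo the monomials of degree >= d only depends on the arguments
   modulo these monomials: the composition is the evaluation of f at the classes
   of the g_i in the quotient ring. *)
Lemma comp_mpoly_mod (k : fieldType) n r d (f f' : {mpoly k[n]})
    (g g' : n.-tuple {mpoly k[r]}) :
  (0 < d)%N ->
  (forall m, (mdeg m < d)%N -> f@_m = f'@_m) ->
  (forall i m, (mdeg m < d)%N -> (tnth g i)@_m = (tnth g' i)@_m) ->
  (forall i, (tnth g i)@_0 = 0) ->
  forall m, (mdeg m < d)%N -> (f \mPo g)@_m = (f' \mPo g')@_m.
Proof.
move=> d_gt0 ff' gg' g0 m md.
have [|||Q [pi [_ piI pik]]] := @quotient_algebra k _ (@mpolyC r k) (@order_ge k r d).
- by move=> m' _; rewrite mcoeff0.
- move=> /(_ 0%MM); rewrite mdeg0 mcoeff1 eqxx => /(_ d_gt0)/eqP.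
  by rewrite oner_eq0.
- move=> a u w uI wI m' md'; rewrite mcoeffD wI // addr0.
  by apply: (order_geM (a := 0) (b := d) _ uI).
suff /piI : pi ((f \mPo g) - (f' \mPo g')) = 0.
  by move=> /(_ m md); rewrite mcoeffB => /eqP; rewrite subr_eq0 => /eqP.
apply/eqP; rewrite rmorphB subr_eq0 !rmorph_comp_mpoly //; apply/eqP.
have -> : (fun i => pi (tnth g' i)) = (fun i => pi (tnth g i)).
  apply/funext => i; apply/subr0_eq; rewrite -rmorphB; apply/piI => m' md'.
  by rewrite mcoeffB gg' ?subrr.
apply: mmap_eq => m' neq.
have dm' : (d <= mdeg m')%N.
  by rewrite leqNgt; apply: contraNN neq => /ff'->.
have -> : \prod_i pi (tnth g i) ^+ m' i = pi (\prod_i tnth g i ^+ m' i).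
  by rewrite rmorph_prod; apply: eq_bigr => i _; rewrite rmorphXn.
apply/piI => m'' lt; apply: (order_ge_monomial (g := tnth g)) (leq_trans lt dm').
by move=> i m3; rewrite ltnS leqn0 mdeg_eq0 => /eqP->.
Qed.

(* The value of f at a tuple of nilpotents of order <= q *)
Definition ps_eval (k : fieldType) n q (f : pseries k n) (R : comAlgType k)
    (v : 'I_n -> R) : R :=
  mmap (in_alg R) v (ps_trunc (n * q).+1 f).

(** Pigeonhole: with all n exponents below q, the degree could not exceed n q. This is why [ps_eval]
    truncates at degree [(n * q).+1]. *)
Lemma monomial_nilp (R : comNzRingType) n q (v : 'I_n -> R) (m : 'X_{1..n}) :
  (forall i, v i ^+ q = 0) -> (n * q < mdeg m)%N -> \prod_i v i ^+ m i = 0.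
Proof.
move=> vq; rewrite mdegE => lt.
have [i qi] : exists i, (q <= m i)%N.
  apply/existsP; apply: contraLR lt; rewrite negb_exists -leqNgt => /forallP H.
  rewrite -[n in (n * q)%N]card_ord -sum_nat_const; apply: leq_sum => i _.
  by apply: ltnW; rewrite ltnNge.
by rewrite (bigD1 i) //= -(subnKC qi) exprD vq !mul0r.
Qed.

Lemma ps_eval_wide (k : fieldType) n q d (f : pseries k n) (R : comAlgType k)
    (v : 'I_n -> R) (P : {mpoly k[n]}) :
  (forall i, v i ^+ q = 0) -> (n * q < d)%N ->
  (forall m, (mdeg m < d)%N -> P@_m = f m) ->
  ps_eval q f v = mmap (in_alg R) v P.
Proof.
move=> vq qd PE; apply: mmap_eq => m neq; apply: (monomial_nilp (q := q)) => //.
rewrite ltnNge; apply: contraNN neq => le; rewrite mcoeff_ps_trunc ltnS le.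
by rewrite PE // (leq_ltn_trans le).
Qed.

Lemma ps_eval_mpoly (k : fieldType) n q (P : {mpoly k[n]}) (R : comAlgType k)
    (v : 'I_n -> R) :
  (forall i, v i ^+ q = 0) ->
  ps_eval q (ps_of_mpoly P) v = mmap (in_alg R) v P.
Proof. by move=> vq; apply: (ps_eval_wide (d := (n * q).+1)). Qed.

Lemma ps_eval_comp (k : fieldType) n r q (f : pseries k n)
    (g : n.-tuple (pseries k r)) (R : comAlgType k) (v : 'I_r -> R) :
  (forall i, tnth g i 0%MM = 0) ->
  (forall i, v i ^+ q = 0) -> (forall i, ps_eval q (tnth g i) v ^+ q = 0) ->
  ps_eval q (ps_comp f g) v = ps_eval q f (fun i => ps_eval q (tnth g i) v).
Proof.
(* [ps_comp] truncates differently at each coefficient. A single d, beyond n q (for f) and r q (for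
   the g_i and the composite), replaces all these truncations. *)
move=> g0 vq gq; pose d := (n * q + r * q).+1.
pose G := [tuple ps_trunc d (tnth g i) | i < n].
have lt_r : (r * q < d)%N by rewrite ltnS leq_addl.
have lt_n : (n * q < d)%N by rewrite ltnS leq_addr.
rewrite (ps_eval_wide (P := ps_trunc d f \mPo G) vq lt_r) => [|m md]; last first.
  apply: (comp_mpoly_mod (d := (mdeg m).+1)); rewrite ?ltnS ?leqnn //.
  - move=> m' m'm; rewrite !mcoeff_ps_trunc m'm ifT //.
    exact: leq_trans m'm md.
  - move=> i m' m'm; rewrite !tnth_mktuple !mcoeff_ps_trunc m'm ifT //.
    exact: leq_trans m'm md.
  - by move=> i; rewrite !tnth_mktuple !mcoeff_ps_trunc g0 if_same.
rewrite (rmorph_comp_mpoly (phi := mmap (in_alg R) v)); last exact: mmapC.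
rewrite (ps_eval_wide (P := ps_trunc d f) gq lt_n); last first.
  by move=> m md; rewrite mcoeff_ps_trunc md.
congr (mmap _ _ _); apply/funext => i; rewrite tnth_mktuple.
rewrite (ps_eval_wide (P := ps_trunc d (tnth g i)) vq lt_r) // => m md.
by rewrite mcoeff_ps_trunc md.
Qed.

Lemma tnth2_map (S T : Type) (f : S -> T) (a b : S) :
  (fun i => f (tnth [tuple a; b] i)) = tnth [tuple f a; f b].
Proof. by apply/funext => -[[|[|i]] Hi]. Qed.

Lemma ps_comp_const (k : fieldType) n r (f : pseries k n)
    (g : n.-tuple (pseries k r)) : ps_comp f g 0%MM = f 0%MM.
Proof.
rewrite /ps_comp mdeg0.
have -> : ps_trunc 1 f = (f 0%MM)%:MP.
  apply/mpolyP => m; rewrite mcoeff_ps_trunc mcoeffC ltnS leqn0 mdeg_eq0 eq_sym.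
  by case: eqP => [->|_]; rewrite ?mulr1 ?mulr0.
by rewrite comp_mpolyC mcoeffC eqxx mulr1.
Qed.

Definition ps_coef (k : fieldType) (f : pseries k 1) (i : nat) : k :=
  f (U_(ord0) *+ i)%MM.

Lemma mnm1_eq (m : 'X_{1..1}) : m = (U_(ord0) *+ m ord0)%MM.
Proof. by apply/mnmP => i; rewrite ord1 mulmnE mnm1E eqxx mul1n. Qed.

Lemma ps_eval1 (k : fieldType) q (f : pseries k 1) (R : comAlgType k) (x : R) :
  x ^+ q = 0 -> ps_eval q f (fun=> x) = \sum_(i < q) ps_coef f i *: x ^+ i.
Proof.
move=> xq.
have -> : \sum_(i < q) ps_coef f i *: x ^+ i = mmap (in_alg R) (fun=> x)
    (\sum_(i < q) ps_coef f i *: 'X_[U_(ord0 : 'I_1) *+ i]).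
  rewrite raddf_sum; apply: eq_bigr => i _.
  rewrite /= mmapZ mmapX /mmap1 big_ord1 mulr_algl.
  by rewrite mulmnE mnm1E eqxx mul1n.
apply: mmap_eq => m; rewrite big_ord1 mcoeff_ps_trunc => neq.
have [mq|qm] := ltnP (m ord0) q; last by rewrite -(subnKC qm) exprD xq mul0r.
case/negP: neq; rewrite raddf_sum (bigD1 (Ordinal mq)) //= big1.
  rewrite addr0 mcoeffZ mcoeffX -mnm1_eq eqxx mulr1 ifT.
    by rewrite /ps_coef -mnm1_eq.
  by rewrite mdegE big_ord1 mul1n ltnW.
move=> i; rewrite -val_eqE /= => im; rewrite mcoeffZ mcoeffX.
case: eqP => [/(congr1 (fun m : 'X_{1..1} => m ord0))|]; last by rewrite mulr0.
by rewrite mulmnE mnm1E eqxx mul1n => /eqP; rewrite (negPf im).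
Qed.

Section FormalGroup.
Variables (k : fieldType) (p : nat).
Hypothesis pk : p \in [pchar k].
Variable F : formal_group_law k.

Local Notation mnm2 i j := [multinom [tuple (i : nat); (j : nat)]].

Lemma mnm2_eq (m : 'X_{1..2}) : m = mnm2 (m ord0) (m ord_max).
Proof.
by apply/mnmP => -[[|[|i]] Hi] //; rewrite multinomE (tnth_nth 0%N) /=;
  congr (m _); apply: val_inj.
Qed.

(** One side bounds each exponent by q, the other the total degree; every monomial on which they
    differ contains x^q or y^q. *)
Lemma fgl_truncE e (R : comAlgType k) (x y : R) :
  x ^+ (p ^ e) = 0 -> y ^+ (p ^ e) = 0 ->
  fgl_trunc p F e x y = ps_eval (p ^ e) F (tnth [tuple x; y]).
Proof.
set q := (p ^ e)%N => xq yq.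
have mprod (m : 'X_{1..2}) :
    \prod_i tnth [tuple x; y] i ^+ m i = x ^+ m ord0 * y ^+ m ord_max.
  by rewrite big_ord_recl big_ord1; congr (_ * _ ^+ m _); apply: val_inj.
have -> : fgl_trunc p F e x y = mmap (in_alg R) (tnth [tuple x; y])
    (\sum_(i < q) \sum_(j < q) fgl_series F (mnm2 i j) *: 'X_[mnm2 i j]).
  rewrite raddf_sum; apply: eq_bigr => i _; rewrite raddf_sum; apply: eq_bigr => j _.
  by rewrite /= mmapZ mmapX /mmap1 mprod mulr_algl.
apply/esym/mmap_eq => m; rewrite mprod mcoeff_ps_trunc => neq.
have [m0q|qm] := ltnP (m ord0) q; last by rewrite -(subnKC qm) exprD xq !mul0r.
have [m1q|qm] := ltnP (m ord_max) q; last by rewrite -(subnKC qm) exprD yq mul0r mulr0.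
case/negP: neq; rewrite raddf_sum (bigD1 (Ordinal m0q)) //= [X in _ + X]big1.
  rewrite addr0 raddf_sum (bigD1 (Ordinal m1q)) //= big1.
    rewrite addr0 mcoeffZ mcoeffX /= (esym (mnm2_eq m)) eqxx mulr1 ifT //.
    rewrite mdegE big_ord_recl big_ord1 mul2n -addnn ltnS.
    rewrite leq_add ?(ltnW m0q) //; apply: ltnW.
    by rewrite (_ : lift _ _ = ord_max) //; apply: val_inj.
  move=> j; rewrite -val_eqE /= => jm; rewrite mcoeffZ mcoeffX.
  rewrite (_ : (_ == m) = false) ?mulr0 //; apply/negbTE.
  by apply: contraNneq jm => <-; rewrite multinomE (tnth_nth 0%N).
move=> i; rewrite -val_eqE /= => im; rewrite raddf_sum big1 //= => j _.
rewrite mcoeffZ mcoeffX.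
rewrite (_ : (_ == m) = false) ?mulr0 //; apply/negbTE.
by apply: contraNneq im => <-; rewrite multinomE (tnth_nth 0%N).
Qed.

Lemma fgl_series_const : fgl_series F 0%MM = 0.
Proof. by rewrite [0%MM]mnm2_eq !mnm0E fgl_const0. Qed.

Section Level.
Variable e : nat.
Local Notation q := (p ^ e)%N.

Lemma q_gt0 : (0 < q)%N.
Proof. by rewrite expn_gt0 prime_gt0 ?(pcharf_prime pk). Qed.

Lemma expr0q (R : comNzRingType) : 0 ^+ q = 0 :> R.
Proof. by rewrite expr0n (gtn_eqF q_gt0). Qed.

Lemma fgl_trunc_nil (R : comAlgType k) (x y : R) :
  x ^+ q = 0 -> y ^+ q = 0 -> fgl_trunc p F e x y ^+ q = 0.
Proof. by move=> /eqP xq /eqP yq; apply/eqP/fgl_trunc_nilp. Qed.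

Lemma ps_eval_fgl_comp n (R : comAlgType k) (f g : pseries k n) (v : 'I_n -> R) :
  f 0%MM = 0 -> g 0%MM = 0 -> (forall i, v i ^+ q = 0) ->
  ps_eval q f v ^+ q = 0 -> ps_eval q g v ^+ q = 0 ->
  ps_eval q (ps_comp F [tuple f; g]) v =
  fgl_trunc p F e (ps_eval q f v) (ps_eval q g v).
Proof.
move=> f0 g0 vq fq gq; rewrite ps_eval_comp //; try by case=> -[|[|i]].
by rewrite (tnth2_map (fun f => ps_eval q f v)) fgl_truncE.
Qed.

Lemma ps_eval_var n (R : comAlgType k) i (v : 'I_n -> R) :
  (forall i, v i ^+ q = 0) -> ps_eval q (ps_var k i) v = v i.
Proof. by move=> vq; rewrite ps_eval_mpoly // mmapX mmap1U. Qed.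

Lemma ps_var_const n i : @ps_var k n i 0%MM = 0.
Proof. by rewrite /ps_var /ps_of_mpoly mcoeffX mnm1_eq0. Qed.

Lemma eq_ps_eval n (R : comAlgType k) (f g : pseries k n) (v : 'I_n -> R) :
  f =1 g -> ps_eval q f v = ps_eval q g v.
Proof. by move=> /funext->. Qed.

Lemma fgl_truncx0 (R : comAlgType k) (x : R) :
  x ^+ q = 0 -> fgl_trunc p F e x 0 = x.
Proof.
move=> xq; pose v (i : 'I_1) := x.
have psT : ps_eval q (ps_var k (ord0 : 'I_1)) v = x by apply: ps_eval_var.
have psO : ps_eval q (ps_of_mpoly (0 : {mpoly k[1]})) v = 0.
  by rewrite ps_eval_mpoly ?mmap0.
have := eq_ps_eval v (fgl_right0 F).
rewrite ps_eval_fgl_comp ?psT ?psO ?expr0q ?ps_var_const //.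
by rewrite /ps_of_mpoly mcoeff0.
Qed.

Lemma fgl_trunc0x (R : comAlgType k) (x : R) :
  x ^+ q = 0 -> fgl_trunc p F e 0 x = x.
Proof.
move=> xq; pose v (i : 'I_1) := x.
have psT : ps_eval q (ps_var k (ord0 : 'I_1)) v = x by apply: ps_eval_var.
have psO : ps_eval q (ps_of_mpoly (0 : {mpoly k[1]})) v = 0.
  by rewrite ps_eval_mpoly ?mmap0.
have := eq_ps_eval v (fgl_left0 F).
rewrite ps_eval_fgl_comp ?psT ?psO ?expr0q ?ps_var_const //.
by rewrite /ps_of_mpoly mcoeff0.
Qed.

Lemma fgl_truncA (R : comAlgType k) (x y z : R) :
  x ^+ q = 0 -> y ^+ q = 0 -> z ^+ q = 0 ->
  fgl_trunc p F e (fgl_trunc p F e x y) z = fgl_trunc p F e x (fgl_trunc p F e y z).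
Proof.
move=> xq yq zq; pose v := tnth [tuple x; y; z].
have vq i : v i ^+ q = 0 by case: i => -[|[|[|i]]].
have vE i : ps_eval q (ps_var k i) v = v i by apply: ps_eval_var.
have [v0 v1 v2] : [/\ v (inord 0) = x, v (inord 1) = y & v (inord 2) = z].
  by split; rewrite /v (tnth_nth 0) inordK.
have := eq_ps_eval v (fgl_assoc F).
by do ![rewrite ps_eval_fgl_comp ?vE ?v0 ?v1 ?v2 ?fgl_trunc_nil //
       ?ps_var_const ?ps_comp_const ?fgl_series_const].
Qed.

Lemma ps_eval_nmul (R : comAlgType k) (x : R) n :
  x ^+ q = 0 ->
  ps_eval q (fgl_nmul F n) (fun=> x) = iter n (fgl_trunc p F e x) 0 /\
  iter n (fgl_trunc p F e x) 0 ^+ q = 0.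
Proof.
move=> xq; elim: n => [|n [IHn nq]] /=.
  by rewrite expr0q ps_eval_mpoly ?mmap0.
rewrite ps_eval_fgl_comp ?IHn ?ps_eval_var ?ps_var_const ?fgl_trunc_nil //.
by case: (n) => [|n'] /=; rewrite ?ps_comp_const ?fgl_series_const // /ps_of_mpoly mcoeff0.
Qed.

End Level.

Lemma fgl_trunc_rmorph e (R S : comAlgType k) (phi : {lrmorphism R -> S}) (x y : R) :
  phi (fgl_trunc p F e x y) = fgl_trunc p F e (phi x) (phi y).
Proof.
rewrite rmorph_sum; apply: eq_bigr => i _; rewrite rmorph_sum; apply: eq_bigr => j _.
by rewrite /= linearZ rmorphM !rmorphXn.
Qed.

End FormalGroup.

(** * The infinitesimal groups G_F[m] *)

Section InfinitesimalGroup.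
Variables (k : fieldType) (p : nat).
Hypothesis pk : p \in [pchar k].
Variable F : formal_group_law k.

Section Inverse.
Variables (e : nat) (R : comAlgType k) (x : R).
Hypothesis xq : x ^+ (p ^ e) = 0.
Let Fx := fgl_trunc p F e x.
Let H y := y - Fx y.

(* The fixed points of [H] are the right inverses of [x]; iterating [H] from [0]
   reaches one because [H] is contracting for the (nilpotent) x-adic topology. *)
Definition fgl_inv : R := iter (p ^ e) H 0.

Let H_nil y : y ^+ (p ^ e) = 0 -> H y ^+ (p ^ e) = 0.
Proof.
move=> yq; have pR : p \in [pchar R] by rewrite pchar_lalg.
have fq : Fx y ^+ (p ^ e) = 0 by apply: fgl_trunc_nil.
have addq (a b : R) : (a + b) ^+ (p ^ e)%N = a ^+ (p ^ e)%N + b ^+ (p ^ e)%N.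
  by apply: exprDn_pchar; rewrite pnatX (eq_pnat _ (pcharf_eq pR)) pnat_id
       ?(pcharf_prime pk).
by rewrite /H addq exprNn fq mulr0 yq addr0.
Qed.

Let H_contract y y' : y ^+ (p ^ e) = 0 -> y' ^+ (p ^ e) = 0 ->
  exists c, H y - H y' = x * (y - y') * c.
Proof.
move=> yq yq'; pose P z := exists c, z = x * (y - y') * c.
have P0 : P 0 by exists 0; rewrite mulr0.
have PD a b : P a -> P b -> P (a + b).
  by move=> [c ->] [d ->]; exists (c + d); ring.
(* Since F(0, y) = y, the monomial X^i Y^j contributes to H y - H y' a multiple of (0^i - x^i)(y^j -
   y'^j), which is divisible by x (y - y'). *)
have -> : H y - H y' =
    (fgl_trunc p F e 0 y - fgl_trunc p F e x y) -
    (fgl_trunc p F e 0 y' - fgl_trunc p F e x y').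
  by rewrite !(fgl_trunc0x pk).
rewrite -!sumrB; apply: (big_ind P) => // i _.
rewrite -!sumrB; apply: (big_ind P) => // j _.
set c := fgl_series F _.
have -> : c *: (0 ^+ i * y ^+ j) - c *: (x ^+ i * y ^+ j) -
     (c *: (0 ^+ i * y' ^+ j) - c *: (x ^+ i * y' ^+ j)) =
   c%:A * ((0 ^+ i - x ^+ i) * (y ^+ j - y' ^+ j)).
  by rewrite -![c *: (_ * _)]mulr_algl; ring.
rewrite !subrXX sub0r; set u := \sum_(_ < _) _; set v := \sum_(_ < _) _.
by exists (- (c%:A * u * v)); ring.
Qed.

Let iter_nil n : iter n H 0 ^+ (p ^ e) = 0.
Proof. by elim: n => [|n IHn]; [exact: (expr0q pk) | rewrite iterS H_nil]. Qed.

Lemma fgl_inv_nil : fgl_inv ^+ (p ^ e) = 0.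
Proof. exact: iter_nil. Qed.

Lemma fgl_mulxV : fgl_trunc p F e x fgl_inv = 0.
Proof.
(* Successive iterates differ by a multiple of x^n, hence by 0 at n = p^e: the iteration has then
   reached a fixed point of H, that is a zero of [Fx]. *)
have step n : exists c, iter n.+1 H 0 - iter n H 0 = x ^+ n * c.
  elim: n => [|n [c IHn]]; first by exists (H 0); rewrite expr0 mul1r subr0.
  have [d] := H_contract (iter_nil n.+1) (iter_nil n); rewrite IHn => dE.
  by exists (c * d); rewrite iterS dE exprS; ring.
have [c] := step (p ^ e)%N; rewrite xq mul0r iterS /H addrAC subrr add0r.
by move=> /eqP; rewrite oppr_eq0 => /eqP.
Qed.

End Inverse.

Lemma fgl_inv_rmorph e (R S : comAlgType k) (phi : {lrmorphism R -> S}) (x : R) :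
  phi (fgl_inv e x) = fgl_inv e (phi x).
Proof.
rewrite /fgl_inv; elim: (p ^ e)%N => [|n IHn]; first by rewrite /= rmorph0.
by rewrite !iterS rmorphB /= fgl_trunc_rmorph IHn.
Qed.

Lemma fgl_mulVx e (R : comAlgType k) (x : R) :
  x ^+ (p ^ e) = 0 -> fgl_trunc p F e (fgl_inv e x) x = 0.
Proof.
move=> xq; set y := fgl_inv e x.
have yq : y ^+ (p ^ e) = 0 by apply: fgl_inv_nil.
set z := fgl_inv e y.
have zq : z ^+ (p ^ e) = 0 by apply: fgl_inv_nil.
have yz : fgl_trunc p F e y z = 0 by apply: fgl_mulxV.
have xy : fgl_trunc p F e x y = 0 by apply: fgl_mulxV.
have := fgl_truncA pk F yq xq (fgl_trunc_nil pk F yq zq).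
rewrite -(fgl_truncA pk F xq yq zq) xy (fgl_trunc0x pk F zq) yz.
by rewrite (fgl_truncx0 pk) // fgl_trunc_nil.
Qed.

Lemma GF_val_nil e R (x : GF k p e R) : val x ^+ (p ^ e) = 0.
Proof. exact/eqP/(valP x). Qed.

Lemma GF_inv_subproof e R (x : GF k p e R) : fgl_inv e (val x) ^+ (p ^ e) == 0.
Proof. by apply/eqP/fgl_inv_nil/GF_val_nil. Qed.

Definition GF_inv e R (x : GF k p e R) : GF k p e R :=
  exist _ (fgl_inv e (val x)) (GF_inv_subproof x).

Lemma GF_mulxV e R (x : GF k p e R) : GF_mul pk F x (GF_inv x) = GF_one pk e R.
Proof. by apply: val_inj; apply: fgl_mulxV; apply: GF_val_nil. Qed.

Lemma GF_mulVx e R (x : GF k p e R) : GF_mul pk F (GF_inv x) x = GF_one pk e R.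
Proof. by apply: val_inj; apply: fgl_mulVx; apply: GF_val_nil. Qed.

Lemma kmap_GF_mul e (R S : comAlgType k) (f : {lrmorphism R -> S}) (x y : GF k p e R) :
  kmap f (GF_mul pk F x y) = GF_mul pk F (kmap f x) (kmap f y).
Proof. by apply: val_inj; apply: fgl_trunc_rmorph. Qed.

Lemma kmap_GF_inv e (R S : comAlgType k) (f : {lrmorphism R -> S}) (x : GF k p e R) :
  kmap f (GF_inv x) = GF_inv (kmap f x).
Proof. by apply: val_inj; apply: fgl_inv_rmorph. Qed.

Lemma kmap_GF_one e (R S : comAlgType k) (f : {lrmorphism R -> S}) :
  kmap f (GF_one pk e R) = GF_one pk e S.
Proof. by apply: val_inj; apply: rmorph0. Qed.

Lemma GF_zariski_sheaf e : zariski_sheaf (GF k p e).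
Proof.
move=> R n f S phi fE floc x compat.
have [|y yE] := glue fE floc (x := fun i => val (x i)).
  by move=> i j T u v uv; have /(congr1 val) := compat i j T u v uv.
have yq : y ^+ (p ^ e) == 0.
  apply/eqP/(glue_uniq fE floc) => i.
  by rewrite rmorphXn rmorph0 /= yE GF_val_nil.
exists (exist _ y yq); split=> [i|y' y'E]; first by apply: val_inj; apply: yE.
apply: val_inj; apply: (glue_uniq fE floc) => i /=.
by rewrite yE -y'E.
Qed.

Lemma kprod_zariski_sheaf (X Y : kfunctor k) :
  zariski_sheaf X -> zariski_sheaf Y -> zariski_sheaf (kprod X Y).
Proof.
move=> hX hY R n f S phi fE floc z compat.
have [|x [xE xU]] := hX R n f S phi fE floc (fun i => (z i).1).
  by move=> i j T u v uv; have [] := compat i j T u v uv.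
have [|y [yE yU]] := hY R n f S phi fE floc (fun i => (z i).2).
  by move=> i j T u v uv; have [] := compat i j T u v uv.
exists (x, y); split=> [i|[x' y'] E] /=; first by rewrite xE yE; case: (z i).
by rewrite (xU x') ?(yU y') // => i; rewrite -E.
Qed.

Lemma sub_full_open (X : kfunctor k) : sub_open (sub_full X).
Proof.
move=> R x; exists (fun r => r = 1) => S phi; split=> // _.
exists 1%N, (fun=> 1), (fun=> 1); split=> //.
by rewrite big_ord1 rmorph1 mulr1.
Qed.

Lemma GF2_affine e : sub_affine (sub_full (kprod (GF k p e) (GF k p e))).
Proof.
have q0 := q_gt0 pk e.
have [A1 [C1 [X1 H1]]] := @truncated_poly_exists k (k^o : comAlgType k) _ q0.
have [A2 [C2 [X2 H2]]] := @truncated_poly_exists k A1 _ q0.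
have x1 : C2 X1 ^+ (p ^ e) == 0 by rewrite -rmorphXn (trunc_nil H1) rmorph0.
have x2 : X2 ^+ (p ^ e) == 0 by rewrite (trunc_nil H2).
exists A2, (exist _ (C2 X1) x1, exist _ X2 x2); split=> // R [x y] _.
have [iota _] := base_lrmorphism R.
have [phi1 [_ phi1X]] := trunc_univ H1 iota (GF_val_nil x).
have [phi2 [phi2C phi2X]] := trunc_univ H2 phi1 (GF_val_nil y).
exists phi2; split.
  congr pair; apply: val_inj => //=.
  by rewrite -phi1X -phi2C.
move=> psi [/(congr1 val)/= psi1 /(congr1 val)/= psi2].
apply: (trunc_eq H2); last by rewrite psi2 phi2X.
apply: (trunc_eq H1 (f := psi \o C2) (g := phi2 \o C2)).
  by move=> a; rewrite /= -[a]mulr1 -[a * 1]/(a *: (1 : k^o)) !linearZ !rmorph1.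
by rewrite /= psi1 -phi1X; have /= -> := phi2C X1.
Qed.

(** [aut_represented] compares automorphisms with points of G over schemes T only; this makes the
    test object admissible. *)
Lemma GF2_scheme e : is_scheme (kprod (GF k p e) (GF k p e)).
Proof.
split; first by apply: kprod_zariski_sheaf; apply: GF_zariski_sheaf.
move=> K _ x; exists (sub_full _); split=> //; first exact: sub_full_open.
exact: GF2_affine.
Qed.

Definition GF2 e : kscheme k := KScheme (GF2_scheme e).

End InfinitesimalGroup.

(** * From F-derivations to homomorphisms into G *)

#[local] Obligation Tactic := idtac.

Section Representation.
Variables (k : fieldType) (p : nat).
Hypothesis pk : p \in [pchar k].
Variables (F : formal_group_law k) (W : kscheme k) (G : kgroup k).
Variable D : F_derivation pk F W.

Local Notation GF2 e := (GF2 pk e).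

Section Level.
Variable e : nat.
Hypothesis e_gt0 : (0 < e)%N.

(* The automorphism (w, (x, y)) |-> (x . w, (x, y)) of W x G_F[e] x G_F[e]; the
   second factor G_F[e] makes room for the multiplication map below. *)
Program Definition der_fun : ktrans (kprod W (GF2 e)) (kprod W (GF2 e)) :=
  {| ktapp := fun R z => (D e R (z.2.1, z.1), z.2) |}.
Next Obligation.
move=> R S f [w [x y]] /=; congr pair.
by rewrite -(ktnat (D e) f (x, w)).
Qed.

Program Definition der_inv : ktrans (kprod W (GF2 e)) (kprod W (GF2 e)) :=
  {| ktapp := fun R z => (D e R (GF_inv pk F z.2.1, z.1), z.2) |}.
Next Obligation.
move=> R S f [w [x y]] /=; congr pair.
by rewrite -(ktnat (D e) f (GF_inv pk F x, w)) /= -kmap_GF_inv.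
Qed.

Program Definition der_aut : autT W (GF2 e) :=
  {| aut_fun := der_fun; aut_inv := der_inv |}.
Next Obligation.
move=> R [w [x y]] /=; congr pair.
by rewrite -(fder_mul D) // GF_mulVx (fder_one D).
Qed.
Next Obligation.
move=> R [w [x y]] /=; congr pair.
by rewrite -(fder_mul D) // GF_mulxV (fder_one D).
Qed.
Next Obligation. by []. Qed.

End Level.

(** These changes of variables stay on the one test scheme. Only their first component matters after
    composition with the classifying map of [der_aut], which factors through the first
    projection. *)
Program Definition GF2_mul e : ktrans (GF2 e) (GF2 e) :=
  {| ktapp := fun R z => (GF_mul pk F z.1 z.2, z.2) |}.
Next Obligation. by move=> e R S f [x y] /=; rewrite -kmap_GF_mul. Qed.

Program Definition GF2_swap e : ktrans (GF2 e) (GF2 e) :=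
  {| ktapp := fun R z => (z.2, z.1) |}.
Next Obligation. by []. Qed.

Program Definition GF2_fst e : ktrans (GF2 e) (GF2 e) :=
  {| ktapp := fun R z => (z.1, GF_one pk e R) |}.
Next Obligation.
by move=> e R S f [x y]; congr pair; apply: val_inj; rewrite /= rmorph0.
Qed.

Program Definition GF2_one e : ktrans (GF2 e) (GF2 e) :=
  {| ktapp := fun R z => (GF_one pk e R, GF_one pk e R) |}.
Next Obligation.
by move=> e R S f [x y]; congr pair; apply: val_inj; rewrite /= rmorph0.
Qed.

Program Definition GF2_incl l e (le : (l <= e)%N) : ktrans (GF2 l) (GF2 e) :=
  {| ktapp := fun R z => (GF_incl pk le z.1, GF_incl pk le z.2) |}.
Next Obligation.
by move=> l e le R S f [x y] /=; congr pair; apply: val_inj.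
Qed.

(** Each [der_aut] is classified by a map f_e to G. The classification is bijective and respects
    products and base change, so the laws of an action become identities between such maps. Levels
    are written [e.+1] because [F_derivation] only constrains positive ones. *)
Lemma derivation_hom : aut_represented W G -> F_derivation_nontrivial D ->
  exists phi : forall (e : nat) (R : comAlgType k), GF k p e.+1 R -> G R,
  [/\ forall e (R S : comAlgType k) (f : {lrmorphism R -> S}) (x : GF k p e.+1 R),
        kmap f (phi e R x) = phi e S (kmap f x),
      forall e R (x y : GF k p e.+1 R),
        phi e R (GF_mul pk F x y) = kgrp_mul (phi e R x) (phi e R y),
      forall l e (le : (l.+1 <= e.+1)%N) R (x : GF k p l.+1 R),
        phi e R (GF_incl pk le x) = phi l R x
    & exists e R (x : GF k p e.+1 R), phi e R x <> phi e R (GF_one pk e.+1 R)].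
Proof.
move=> [Phi [Phi_inj Phi_surj Phi_mul Phi_pull]] nontriv.
pose f e := sval (cid (Phi_surj _ (@der_aut e.+1 (ltn0Sn e)))).
have fE e : aut_eq (Phi _ (f e)) (@der_aut e.+1 (ltn0Sn e)).
  exact: svalP (cid (Phi_surj _ _)).
clearbody f.
have fpull e (T : kscheme k) (h : ktrans T (GF2 e.+1)) (R : comAlgType k) (w : W R) (t : T R) :
    aut_fun (Phi T (ktcomp (f e) h)) R (w, t) = (D e.+1 R ((h R t).1, w), t).
  by rewrite Phi_pull /= fE.
pose phi e (R : comAlgType k) (x : GF k p e.+1 R) : G R := f e R (x, GF_one pk e.+1 R).
(* The automorphism acts through the first coordinate only, hence so does its classifying map. *)
have f_fst e (R : comAlgType k) (z : GF2 e.+1 R) : f e R z = phi e R z.1.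
  suff /Phi_inj H : aut_eq (Phi _ (f e)) (Phi _ (ktcomp (f e) (GF2_fst e.+1))).
    exact: H.
  by move=> S [w t]; rewrite fpull fE.
exists phi; split.
- move=> e R S g x; rewrite /phi -(kmap_GF_one pk e.+1 g).
  by rewrite -(ktnat (f e) g (x, GF_one pk e.+1 R)).
- move=> e R x y.
  suff /Phi_inj H : aut_eq (Phi _ (ktcomp (f e) (GF2_mul e.+1)))
      (Phi _ (khom_mul (f e) (ktcomp (f e) (GF2_swap e.+1)))).
    have /= := H R (x, y); rewrite !f_fst /=; exact.
  move=> S [w [x' y']]; rewrite fpull Phi_mul /= fpull fE /=.
  by rewrite -(fder_mul D).
- move=> l e le R x.
  suff /Phi_inj H : aut_eq (Phi _ (ktcomp (f e) (GF2_incl le))) (Phi _ (f l)).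
    by have /= := H R (x, GF_one pk _ R); rewrite !f_fst.
  by move=> S [w [x' y']]; rewrite fpull fE /= (fder_compat D).
- apply: contrapT => triv; case: nontriv => -[|e] [R [x [w [// _ neq]]]]; case: neq.
  (* If phi were constant, f_e would equal its composite with the trivial map, and every point would
     act as the unit. *)
  have phi1 S x' : phi e S x' = phi e S (GF_one pk e.+1 S).
    by apply: contrapT => neq; apply: triv; exists e, S, x'.
  have : aut_eq (Phi _ (f e)) (Phi _ (ktcomp (f e) (GF2_one e.+1))).
    by apply/Phi_inj => S z /=; rewrite !f_fst phi1.
  move=> /(_ R (w, (x, x))); rewrite fpull fE /= (fder_one D) //.
  by case.
Qed.

End Representation.

(** * Representative functions *)

Lemma kmap_eq (k : fieldType) (X : kfunctor k) (A R : comAlgType k)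
    (f g : {lrmorphism A -> R}) (x : X A) : f =1 g -> kmap f x = kmap g x.
Proof.
move=> fg; have /(_ x)/= -> := @kmap_comp k X A A R idfun g f fg.
by rewrite kmap_id.
Qed.

Section Comultiplication.
Variables (k : fieldType) (G : kgroup k) (A : comAlgType k) (u : G A).
Hypothesis Au : sub_Spec (sub_full G) u.

Lemma Spec_ex R (x : G R) : exists phi : {lrmorphism A -> R}, kmap phi u = x.
Proof. by have [_ /(_ R x I)[phi [phiu _]]] := Au; exists phi. Qed.

Lemma Spec_uniq (R : comAlgType k) (f g : {lrmorphism A -> R}) :
  kmap f u = kmap g u -> f =1 g.
Proof.
move=> fg b; have [_ /(_ R (kmap g u) I)[phi [_ phiU]]] := Au.
by rewrite (phiU f fg) (phiU g).
Qed.

(* The comultiplication of a lands in the image of A (x) A; here the tensor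
   product is presented as a quotient of A[Y_1, ..., Y_n], where A = k[v_1, ..., v_n]. *)
Lemma comultiplication (a : A) : alg_finite_type A ->
  exists L (b c : 'I_L -> A), forall (R : comAlgType k)
    (xi zeta chi : {lrmorphism A -> R}),
    kmap chi u = kgrp_mul (kmap xi u) (kmap zeta u) ->
    chi a = \sum_l xi (b l) * zeta (c l).
Proof.
move=> [n [v /choice[Q QE]]].
pose ev (R : comAlgType k) (xi zeta : {lrmorphism A -> R}) :
  {rmorphism {mpoly A[n]} -> R} := mmap xi (zeta \o v).
pose i : {rmorphism k -> {mpoly A[n]}} := @mpolyC n A \o in_alg A.
(* Defining the ideal by all evaluations at pairs of points reduces every identity in B, such as the
   multiplicativity of [i2], to its image under each [ev R xi zeta]. *)
pose J (P : {mpoly A[n]}) := forall (R : comAlgType k)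
  (xi zeta : {lrmorphism A -> R}), ev R xi zeta P = 0.
have [|||B [pi [pi_surj piJ pik]]] := @quotient_algebra k _ i J.
- by move=> R xi zeta; rewrite rmorph0.
- by move=> /(_ A idfun idfun)/eqP; rewrite rmorph1 oner_eq0.
- by move=> P S U JS JU R xi zeta; rewrite rmorphD rmorphM JS JU mulr0 addr0.
have piE P S : (forall (R : comAlgType k) (xi zeta : {lrmorphism A -> R}),
    ev R xi zeta P = ev R xi zeta S) -> pi P = pi S.
  move=> PS; apply/subr0_eq; rewrite -rmorphB; apply/piJ => R xi zeta.
  by rewrite rmorphB /= PS subrr.
have evC R xi zeta b : ev R xi zeta b%:MP = xi b by apply: mmapC.
have evQ R xi zeta b : ev R xi zeta (map_mpoly (in_alg A) (Q b)) = zeta b.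
  rewrite [in RHS](QE b) /map_mpoly /mmap !rmorph_sum; apply: eq_bigr => m _.
  rewrite !rmorphM evC /= !lrmorphism_in_alg /mmap1 !rmorph_prod; congr (_ * _).
  apply: eq_bigr => j _; rewrite !rmorphXn; congr (_ ^+ _).
  by rewrite /ev /= mmapX mmap1U.
have [|||c x|i1 i1E] := @lrmorphism_of k A B (pi \o @mpolyC n A).
- by move=> x y; rewrite /= !rmorphD.
- by move=> x y; rewrite /= !rmorphM.
- by rewrite /= !rmorph1.
- rewrite /= -[c *: x]mulr_algl rmorphM rmorphM.
  by rewrite -[pi (_%:A)%:MP]/(pi (i c)) pik mulr_algl.
have [|||c x|i2 i2E] := @lrmorphism_of k A B (fun b => pi (map_mpoly (in_alg A) (Q b))).
- by move=> x y; rewrite -rmorphD; apply: piE => R xi zeta; rewrite rmorphD /= !evQ rmorphD.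
- by move=> x y; rewrite -rmorphM; apply: piE => R xi zeta; rewrite rmorphM /= !evQ rmorphM.
- by rewrite -(rmorph1 pi); apply: piE => R xi zeta; rewrite evQ !rmorph1.
- rewrite -[RHS]mulr_algl -pik -rmorphM; apply: piE => R xi zeta.
  by rewrite rmorphM /= !evQ evC lrmorphism_in_alg mulr_algl linearZ.
(* [m] is the comultiplication: it represents the product of the two universal points over B. Once m
   a is the class of a polynomial P, the b_l are the coefficients of P and the c_l its monomials,
   evaluated at v. *)
have [m mE] := Spec_ex (kgrp_mul (kmap i1 u) (kmap i2 u)).
have [P PE] := pi_surj (m a); pose ms : seq 'X_{1..n} := msupp P.
exists (size ms), (fun l => P@_(nth 0%MM ms l)),
  (fun l => \prod_j v j ^+ (nth 0%MM ms l) j) => R xi zeta chi chiE.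
have [||Phi PhiE] := quotient_lift pi_surj pik (g := ev R xi zeta).
- by move=> c; rewrite evC lrmorphism_in_alg.
- by move=> S /piJ.
have Phi1 : Phi \o i1 =1 xi by move=> b; rewrite /= i1E PhiE evC.
have Phi2 : Phi \o i2 =1 zeta by move=> b; rewrite /= i2E PhiE evQ.
have H : chi =1 Phi \o m.
  apply: Spec_uniq; rewrite chiE.
  rewrite (kmap_comp (f := m) (g := Phi) (h := Phi \o m)) //= mE kgrp_mul_nat.
  rewrite -[kmap Phi (kmap i1 u)]/((kmap Phi \o kmap i1) u).
  rewrite -[kmap Phi (kmap i2 u)]/((kmap Phi \o kmap i2) u).
  rewrite -(kmap_comp (h := Phi \o i1)) // -(kmap_comp (h := Phi \o i2)) //.
  by rewrite (kmap_eq u Phi1) (kmap_eq u Phi2).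
rewrite H /= PE PhiE /ev /= /mmap (big_nth 0%MM) big_mkord; apply: eq_bigr => l _.
rewrite /mmap1 rmorph_prod; congr (_ * _); apply: eq_bigr => j _.
by rewrite rmorphXn.
Qed.

End Comultiplication.

Section RepresentativeFunction.
Variables (k : fieldType) (p : nat).
Hypothesis pk : p \in [pchar k].
Variables (F : formal_group_law k) (G : kgroup k) (A : comAlgType k) (u : G A).
Hypothesis Au : sub_Spec (sub_full G) u.
Variable phi : forall (e : nat) (R : comAlgType k), GF k p e.+1 R -> G R.
Hypothesis phi_nat :
  forall e (R S : comAlgType k) (f : {lrmorphism R -> S}) (x : GF k p e.+1 R),
  kmap f (phi x) = phi (kmap f x).
Hypothesis phi_incl : forall l e (le : (l.+1 <= e.+1)%N) (R : comAlgType k)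
  (x : GF k p l.+1 R), phi (GF_incl pk le x) = phi x.

(** T = k[X] / (X^q), with q = p^(e + 1), carries the universal point X of G_F[e + 1]. The
    coefficients are those of the image of b in T, and any other point is a specialization of X. *)
Lemma coordinate_series_level e : exists lam : A -> nat -> k,
  forall (R : comAlgType k) (x : GF k p e.+1 R) (zeta : {lrmorphism A -> R}),
  kmap zeta u = phi x ->
  forall b, zeta b = \sum_(i < p ^ e.+1) lam b i *: val x ^+ i.
Proof.
have [T [C [X H]]] := @truncated_poly_exists k (k^o : comAlgType k) _ (q_gt0 pk e.+1).
have Xq : X ^+ (p ^ e.+1) == 0 by rewrite (trunc_nil H).
pose XT : GF k p e.+1 T := exist _ X Xq.
have [zT zTE] := Spec_ex Au (phi XT).
have [lam lamE] := choice (fun b => trunc_gen H (zT b)).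
exists lam => R x zeta zetaE b.
have [iota _] := base_lrmorphism R.
have [Phi [_ PhiX]] := trunc_univ H iota (GF_val_nil x).
have PhiXT : kmap Phi XT = x by apply: val_inj.
have -> : zeta b = (Phi \o zT) b.
  apply: (Spec_uniq Au); rewrite zetaE (kmap_comp (f := zT) (g := Phi)) //=.
  by rewrite zTE phi_nat PhiXT.
rewrite /= lamE rmorph_sum; apply: eq_bigr => i _.
by rewrite rmorphM rmorphXn /= PhiX lrmorphism_base lrmorphism_in_alg mulr_algl.
Qed.

Lemma coordinate_series : exists lam : A -> nat -> k,
  forall e (R : comAlgType k) (x : GF k p e.+1 R) (zeta : {lrmorphism A -> R}),
  kmap zeta u = phi x ->
  forall b, zeta b = \sum_(i < p ^ e.+1) lam b i *: val x ^+ i.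
Proof.
have [lam lamE] := choice coordinate_series_level.
have p_gt1 : (1 < p)%N by rewrite prime_gt1 ?(pcharf_prime pk).
have compat l e b i : (l <= e)%N -> (i < p ^ l.+1)%N -> lam e b i = lam l b i.
  move=> le il.
  have [T [C [X H]]] := @truncated_poly_exists k (k^o : comAlgType k) _ (q_gt0 pk l.+1).
  have Xq : X ^+ (p ^ l.+1) == 0 by rewrite (trunc_nil H).
  pose XT : GF k p l.+1 T := exist _ X Xq.
  have [zT zTE] := Spec_ex Au (phi XT).
  have zl := lamE l _ _ _ zTE b.
  rewrite -(phi_incl (l := l) (e := e) le) in zTE.
  have := lamE e _ _ _ zTE b; rewrite zl /=.
  have qq : (p ^ l.+1 <= p ^ e.+1)%N by rewrite leq_pexp2l // ltnW.
  rewrite -(big_mkord xpredT (fun i => lam e b i *: X ^+ i)).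
  rewrite (big_cat_nat (leq0n _) qq) /= [X in _ + X]big1_seq ?addr0; last first.
    move=> j; rewrite mem_index_iota => /andP[_ /andP[lj _]].
    by rewrite -(subnKC lj) exprD (eqP Xq) mul0r scaler0.
  rewrite big_mkord => E.
  have baseE (a : nat -> k) :
      \sum_(j < p ^ l.+1) C (a j) * X ^+ j = \sum_(j < p ^ l.+1) a j *: X ^+ j.
    by apply: eq_bigr => j _; rewrite lrmorphism_base mulr_algl.
  have EE : \sum_(j < p ^ l.+1) C (lam e b j) * X ^+ j =
      \sum_(j < p ^ l.+1) C (lam l b j) * X ^+ j by rewrite !baseE -E.
  exact: (trunc_inj H EE il).
(* The levels agree by [compat], so the i-th coefficient may be read at level i, where i < p^(i +
   1). *)
exists (fun b i => lam i b i) => e R x zeta zetaE b.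
rewrite (lamE e _ _ _ zetaE); apply: eq_bigr => i _; congr (_ *: _).
have [ei|ie] := leqP e i; first by rewrite -(compat e i).
rewrite (compat i e) ?(ltnW ie) //.
by apply: leq_trans (ltn_expl _ p_gt1) _; rewrite leq_pexp2l // ltnW.
Qed.

Hypothesis A_fin : alg_finite_type A.
Hypothesis phi_mul : forall e (R : comAlgType k) (x y : GF k p e.+1 R),
  phi (GF_mul pk F x y) = kgrp_mul (phi x) (phi y).
Hypothesis phi_neq : exists e (R : comAlgType k) (x : GF k p e.+1 R),
  phi x <> phi (GF_one pk e.+1 R).

(** The series is the pullback of a function [a] on G that is not constant along phi; the finite sum
    expressing the comultiplication of [a] bounds the rank of lam(F(x, y)). *)
Lemma representative_function : exists L (lam : nat -> k) (r s : nat -> 'I_L -> k),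
  (exists2 n, (0 < n)%N & lam n != 0) /\
  forall e (R : comAlgType k) (x y : R),
    x ^+ (p ^ e.+1) = 0 -> y ^+ (p ^ e.+1) = 0 ->
    \sum_(n < p ^ e.+1) lam n *: fgl_trunc p F e.+1 x y ^+ n =
    \sum_l (\sum_(i < p ^ e.+1) r i l *: x ^+ i) *
           (\sum_(j < p ^ e.+1) s j l *: y ^+ j).
Proof.
have [lam lamE] := coordinate_series.
have [a [n n_gt0 lamn]] : exists a, exists2 n, (0 < n)%N & lam a n != 0.
  apply: contrapT => H; case: phi_neq => e [R [x]]; apply.
  have lam0 a n : (0 < n)%N -> lam a n = 0.
    by move=> n_gt0; apply: contrapT => /eqP ne; apply: H; exists a, n.
  have [z zE] := Spec_ex Au (phi x).
  have [z1 z1E] := Spec_ex Au (phi (GF_one pk e.+1 R)).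
  rewrite -zE -z1E; apply: kmap_eq => b; rewrite (lamE _ _ _ _ zE) (lamE _ _ _ _ z1E).
  apply: eq_bigr => -[[|i] ?] _ /=; first by rewrite !expr0.
  by rewrite lam0 // !scale0r.
have [L [b [c bcE]]] := comultiplication Au a A_fin.
exists L, (lam a), (fun i l => lam (b l) i), (fun j l => lam (c l) j).
split; first by exists n.
move=> e R x y /eqP xq /eqP yq.
pose X : GF k p e.+1 R := exist _ x xq; pose Y : GF k p e.+1 R := exist _ y yq.
have [zx zxE] := Spec_ex Au (phi X).
have [zy zyE] := Spec_ex Au (phi Y).
have [z zE] := Spec_ex Au (phi (GF_mul pk F X Y)).
rewrite -[LHS](lamE _ _ _ _ zE) (bcE R zx zy z); last by rewrite zE zxE zyE phi_mul.
by apply: eq_bigr => l _; rewrite (lamE _ _ _ _ zxE) (lamE _ _ _ _ zyE).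
Qed.

End RepresentativeFunction.

(** * From finite rank to matrices *)

(** A rank factorization for an infinite sequence: the ranks of initial segments are bounded by L,
    and at a length N where the rank is maximal the first N vectors span all the others. *)
Lemma span_seq (k : fieldType) L (r : nat -> 'rV[k]_L) :
  exists d (B : 'M[k]_(d, L)) (a : nat -> 'rV[k]_d) N,
    [/\ forall i, r i = a i *m B, row_free B & row_full (\matrix_(i < N) a i)].
Proof.
pose RN N : 'M[k]_(N, L) := \matrix_(i < N) r i.
pose P d := `[< exists N, \rank (RN N) = d >].
have exP : exists d, P d by exists (\rank (RN 0%N)); apply/asboolP; exists 0%N.
have ubP d : P d -> (d <= L)%N by move=> /asboolP[N <-]; apply: rank_leq_col.
case: (ex_maxnP exP ubP) => d /asboolP[N rkN] dmax.
have sub i : (r i <= RN N)%MS.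
  pose N' := maxn N i.+1.
  have RNN' : (RN N <= RN N')%MS.
    apply/row_subP => j; have jN' : (j < N')%N by rewrite (leq_trans (ltn_ord j)) ?leq_maxl.
    by rewrite rowK -[r j](rowK (fun j : 'I_N' => r j) (Ordinal jN')) row_sub.
  have iN' : (i < N')%N by rewrite leq_maxr.
  have : (r i <= RN N')%MS.
    by rewrite -[r i](rowK (fun j : 'I_N' => r j) (Ordinal iN')) row_sub.
  move/submx_trans; apply; rewrite -(geq_leqif (mxrank_leqif_sup RNN')) rkN.
  by apply: dmax; apply/asboolP; exists N'.
pose B := row_base (RN N).
pose a i := r i *m pinvmx B.
have aE i : r i = a i *m B by rewrite mulmxKpV // eq_row_base.
exists (\rank (RN N)), B, a, N; split=> //; first exact: row_base_free.
have RNE : RN N = (\matrix_(i < N) a i) *m B.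
  by apply/row_matrixP => i; rewrite row_mul !rowK -aE.
by rewrite /row_full eqn_leq rank_leq_col /= {1}RNE mxrankM_maxl.
Qed.

Section Regular.
Variables (k : fieldType) (c : nat -> nat -> nat -> k).
Hypothesis c_big : forall n i j, (i + j < n)%N -> c n i j = 0.
Hypothesis c_r0 : forall n i, c n i 0%N = (n == i)%:R.
Hypothesis c_0l : forall n j, c n 0%N j = (n == j)%:R.
Hypothesis cA : forall n i j l,
  \sum_(m < (i + j).+1) c m i j * c n m l = \sum_(m < (j + l).+1) c m j l * c n i m.

Lemma c_wide (V : lmodType k) (f : nat -> V) i j N : (i + j < N)%N ->
  \sum_(m < (i + j).+1) c m i j *: f m = \sum_(m < N) c m i j *: f m.
Proof.
move=> ijN; rewrite -!(big_mkord xpredT (fun m => c m i j *: f m)).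
rewrite [RHS](big_cat_nat (leq0n _) ijN) /= [X in _ + X]big1_seq ?addr0 // => m.
by rewrite mem_index_iota => /andP[_ /andP[lt _]]; rewrite c_big ?scale0r.
Qed.

(** With e_i e_j = sum_n c n i j e_n, this is associativity pushed forward along the linear map e_n
    |-> f n. An arbitrary target V lets it serve both the form [lam] and the vectors [S n]. *)
Lemma c_sumA (V : lmodType k) (f : nat -> V) i j l :
  \sum_(m < (i + j).+1) c m i j *: (\sum_(n < (m + l).+1) c n m l *: f n) =
  \sum_(m < (j + l).+1) c m j l *: (\sum_(n < (i + m).+1) c n i m *: f n).
Proof.
pose N := (i + j + l).+1.
have lhs (m : 'I_(i + j).+1) :
    \sum_(n < (m + l).+1) c n m l *: f n = \sum_(n < N) c n m l *: f n.
  by apply: c_wide; rewrite ltnS leq_add2r -ltnS.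
have rhs (m : 'I_(j + l).+1) :
    \sum_(n < (i + m).+1) c n i m *: f n = \sum_(n < N) c n i m *: f n.
  by apply: c_wide; rewrite ltnS -addnA leq_add2l -ltnS.
under eq_bigr do rewrite lhs scaler_sumr.
under [RHS]eq_bigr do rewrite rhs scaler_sumr.
rewrite exchange_big [RHS]exchange_big; apply: eq_bigr => n _ /=.
under eq_bigr do rewrite scalerA.
under [RHS]eq_bigr do rewrite scalerA.
by rewrite -!scaler_suml cA.
Qed.

Lemma c_sum_0l (V : lmodType k) (f : nat -> V) j :
  \sum_(n < (0 + j).+1) c n 0%N j *: f n = f j.
Proof.
rewrite add0n big_ord_recr big1 /= => [|n _]; last first.
  by rewrite c_0l (ltn_eqF (ltn_ord n)) scale0r.
by rewrite c_0l eqxx scale1r add0r.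
Qed.

Lemma c_sum_r0 (V : lmodType k) (f : nat -> V) i :
  \sum_(n < (i + 0).+1) c n i 0%N *: f n = f i.
Proof.
rewrite addn0 big_ord_recr big1 /= => [|n _]; last first.
  by rewrite c_r0 (ltn_eqF (ltn_ord n)) scale0r.
by rewrite c_r0 eqxx scale1r add0r.
Qed.

(* If the bilinear form (e_i, e_j) |-> lam (e_i e_j) on the algebra with structure
   constants c has finite rank, its left kernel is a left ideal of finite
   codimension, on whose quotient the algebra acts by matrices. *)
Lemma finite_rank_representation L (lam : nat -> k) (r s : nat -> 'I_L -> k) :
  (exists2 n, (0 < n)%N & lam n != 0) ->
  (forall i j, \sum_(n < (i + j).+1) c n i j * lam n = \sum_l r i l * s j l) ->
  exists d (M : nat -> 'M[k]_d),
    [/\ M 0%N = 1%:M,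
        forall i j, M i *m M j = \sum_(n < (i + j).+1) c n i j *: M n
      & exists2 n, (0 < n)%N & M n != 0].
Proof.
move=> [n0 n0_gt0 lam_n0] rank_lam.
(* Two factorizations, of the left and then of the right vectors, write the form as R_i S_j in
   dimension d, with the R_i spanning all rows and the S_j all columns. *)
have [d1 [B1 [a [N [aE _ /row_fullP[rho rhoE]]]]]] := span_seq (fun i => \row_l r i l).
have [d [B [b [N' [bE /row_freeP[sigma sigmaE] /row_fullP[tau tauE]]]]]] :=
  span_seq (fun j => (B1 *m \col_l s j l)^T).
pose R i := a i *m B^T; pose S j := (b j)^T.
pose H i j := \sum_(n < (i + j).+1) c n i j *: (lam n)%:M : 'M[k]_1.
have RS i j : R i *m S j = H i j.
  rewrite /R /S -mulmxA -trmx_mul -bE trmxK mulmxA -aE.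
  apply/matrixP => x y; rewrite !ord1 /H summxE !mxE.
  under eq_bigr do rewrite !mxE.
  by rewrite -rank_lam; apply: eq_bigr => n _; rewrite !mxE eqxx mulr1n.
pose RN := \matrix_(i < N) R i.
have rhoR : (sigma^T *m rho) *m RN = 1%:M.
  have -> : RN = (\matrix_(i < N) a i) *m B^T.
    by apply/row_matrixP => i; rewrite row_mul !rowK.
  by rewrite mulmxA -[sigma^T *m _ *m _]mulmxA rhoE mulmx1 -trmx_mul sigmaE trmx1.
have S_inj (m : nat) (X Y : 'M_(m, d)) : (forall j, X *m S j = Y *m S j) -> X = Y.
  move=> XY; apply: trmx_inj; rewrite -[LHS]mul1mx -[RHS]mul1mx -tauE -!mulmxA.
  congr (_ *m _); apply/row_matrixP => j; rewrite !row_mul rowK.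
  by apply: trmx_inj; rewrite !trmx_mul !trmxK XY.
(* [M n] is left multiplication by e_n: M_n S_j = S(e_n e_j), with S extended linearly. This is
   checked against the spanning R_i, where associativity moves e_n to the left factor. *)
pose M n := (sigma^T *m rho) *m
  \matrix_(i < N) (\sum_(m < (i + n).+1) c m i n *: R m).
have MS n j : M n *m S j = \sum_(m < (n + j).+1) c m n j *: S m.
  rewrite -[RHS]mul1mx -rhoR /M -!mulmxA; congr (_ *m (_ *m _)).
  apply/row_matrixP => i; rewrite !row_mul !rowK mulmx_suml mulmx_sumr.
  under eq_bigr do rewrite -scalemxAl RS.
  under [RHS]eq_bigr do rewrite -scalemxAr RS.
  exact: (c_sumA (fun n => (lam n)%:M)).
exists d, M; split.
- by apply: (S_inj d) => j; rewrite MS c_sum_0l mul1mx.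
- move=> i n; apply: (S_inj d) => j; rewrite -mulmxA MS mulmx_sumr mulmx_suml.
  under eq_bigr do rewrite -scalemxAr MS.
  under [RHS]eq_bigr do rewrite -scalemxAl MS.
  by rewrite -c_sumA.
(* As e_0 is the unit, S_n0 = M_n0 S_0 and lam n0 = R_0 S_n0; hence M_n0 = 0 would give lam n0 =
   0. *)
- exists n0 => //; apply: contraNneq lam_n0 => M0.
  have := RS 0%N n0; have := MS n0 0%N; rewrite M0 mul0mx c_sum_r0 => <-.
  rewrite mulmx0 /H (c_sum_0l (fun n => (lam n)%:M)) => /matrixP/(_ ord0 ord0).
  by rewrite !mxE eqxx mulr1n => <-.
Qed.

End Regular.

(** * The structure constants of F *)

Lemma horner_nilp (R : comNzRingType) (P : {poly R}) q (x : R) :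
  x ^+ q = 0 -> P.[x] = \sum_(n < q) P`_n * x ^+ n.
Proof.
move=> xq; rewrite (@horner_coef_wide _ (maxn (size P) q)) ?leq_maxl //.
rewrite -!(big_mkord xpredT (fun n => P`_n * x ^+ n)).
rewrite (big_cat_nat (leq0n q)) ?leq_maxr //= [X in _ + X]big1_seq ?addr0 // => n.
rewrite mem_index_iota => /andP[_ /andP[qn _]].
by rewrite -(subnKC qn) exprD xq mul0r mulr0.
Qed.

Lemma mul_sum_nilp (R : comNzRingType) (f g : nat -> R) q (x : R) :
  x ^+ q = 0 ->
  (\sum_(i < q) f i * x ^+ i) * (\sum_(i < q) g i * x ^+ i) =
  \sum_(n < q) (\sum_(i < n.+1) f i * g (n - i)%N) * x ^+ n.
Proof.
move=> xq; have hE h : (\poly_(i < q) h i).[x] = \sum_(i < q) h i * x ^+ i.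
  by rewrite (horner_nilp _ xq); apply: eq_bigr => i _; rewrite coef_poly ltn_ord.
rewrite -(hE f) -(hE g) -hornerM (horner_nilp _ xq); apply: eq_bigr => n _.
rewrite coefM; congr (_ * _); apply: eq_bigr => i _.
rewrite !coef_poly (leq_ltn_trans _ (ltn_ord n)) ?(leq_ltn_trans _ (ltn_ord n)) //.
  by rewrite leq_subr.
by rewrite -ltnS.
Qed.

(** The way back from values to coefficients: an identity at one generic nilpotent element of order
    q determines all coefficients below q. *)
Lemma monomials_free (k : fieldType) q : (0 < q)%N ->
  exists (R : comAlgType k) (X : R), X ^+ q = 0 /\
    forall a b : nat -> k,
      \sum_(i < q) a i *: X ^+ i = \sum_(i < q) b i *: X ^+ i ->
      forall i, (i < q)%N -> a i = b i.
Proof.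
move=> q0.
have [T [C [X H]]] := @truncated_poly_exists k (k^o : comAlgType k) _ q0.
exists T, X; split=> [|a b ab]; first exact: trunc_nil H.
have sumE (f : nat -> k) :
    \sum_(i < q) C (f i) * X ^+ i = \sum_(i < q) f i *: X ^+ i.
  by apply: eq_bigr => i _; rewrite lrmorphism_base mulr_algl.
have ab' : \sum_(i < q) C (a i) * X ^+ i = \sum_(i < q) C (b i) * X ^+ i.
  by rewrite !sumE.
exact: trunc_inj H ab'.
Qed.

Lemma trivariate_monomials_free (k : fieldType) q : (0 < q)%N ->
  exists (R : comAlgType k) (X Y Z : R),
    [/\ X ^+ q = 0, Y ^+ q = 0, Z ^+ q = 0
      & forall a b : nat -> nat -> nat -> k,
        \sum_(l < q) \sum_(j < q) \sum_(i < q) a i j l *: (X ^+ i * Y ^+ j * Z ^+ l) =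
        \sum_(l < q) \sum_(j < q) \sum_(i < q) b i j l *: (X ^+ i * Y ^+ j * Z ^+ l) ->
        forall i j l, (i < q)%N -> (j < q)%N -> (l < q)%N -> a i j l = b i j l].
Proof.
move=> q0.
have [T1 [C1 [X1 H1]]] := @truncated_poly_exists k (k^o : comAlgType k) _ q0.
have [T2 [C2 [X2 H2]]] := @truncated_poly_exists k T1 _ q0.
have [T3 [C3 [X3 H3]]] := @truncated_poly_exists k T2 _ q0.
exists T3, (C3 (C2 X1)), (C3 X2), X3; split.
- by rewrite -!rmorphXn (trunc_nil H1) !rmorph0.
- by rewrite -!rmorphXn (trunc_nil H2) !rmorph0.
- exact: trunc_nil H3.
move=> a b ab i j l iq jq lq.
have sumE (f : nat -> nat -> nat -> k) :
    \sum_(l < q) \sum_(j < q) \sum_(i < q)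
       f i j l *: (C3 (C2 X1) ^+ i * C3 X2 ^+ j * X3 ^+ l) =
    \sum_(l < q) C3 (\sum_(j < q) C2 (\sum_(i < q) C1 (f i j l) * X1 ^+ i)
       * X2 ^+ j) * X3 ^+ l.
  apply: eq_bigr => l' _; rewrite rmorph_sum mulr_suml; apply: eq_bigr => j' _.
  rewrite rmorphM rmorph_sum rmorph_sum !mulr_suml; apply: eq_bigr => i' _.
  rewrite lrmorphism_base mulr_algl /= !linearZ /= !rmorphXn -!scalerAl.
  by [].
rewrite !sumE in ab.
have e3 := trunc_inj (a := fun l => \sum_(j < q) C2 (\sum_(i < q) C1 (a i j l) * X1 ^+ i)
  * X2 ^+ j) (b := fun l => \sum_(j < q) C2 (\sum_(i < q) C1 (b i j l) * X1 ^+ i)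
  * X2 ^+ j) H3 ab lq.
have e2 := trunc_inj (a := fun j => \sum_(i < q) C1 (a i j l) * X1 ^+ i)
  (b := fun j => \sum_(i < q) C1 (b i j l) * X1 ^+ i) H2 e3 jq.
pose a' i : (k^o : comAlgType k) := a i j l.
pose b' i : (k^o : comAlgType k) := b i j l.
exact: (@trunc_inj _ _ _ _ _ _ a' b' H1 e2 i iq).
Qed.

Lemma bivariate_monomials_free (k : fieldType) q : (0 < q)%N ->
  exists (R : comAlgType k) (X Y : R),
    [/\ X ^+ q = 0, Y ^+ q = 0
      & forall a b : nat -> nat -> k,
        \sum_(i < q) \sum_(j < q) a i j *: (X ^+ i * Y ^+ j) =
        \sum_(i < q) \sum_(j < q) b i j *: (X ^+ i * Y ^+ j) ->
        forall i j, (i < q)%N -> (j < q)%N -> a i j = b i j].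
Proof.
move=> q0; have [R [X [Y [Z [Xq Yq Zq free]]]]] := trivariate_monomials_free k q0.
exists R, X, Y; split=> // a b ab i j iq jq.
apply: (free (fun i j l => a i j) (fun i j l => b i j)) iq jq q0.
have sumE (f : nat -> nat -> k) l :
    \sum_(j < q) \sum_(i < q) f i j *: (X ^+ i * Y ^+ j * Z ^+ l) =
    (\sum_(i < q) \sum_(j < q) f i j *: (X ^+ i * Y ^+ j)) * Z ^+ l.
  rewrite [in RHS]exchange_big mulr_suml; apply: eq_bigr => j' _.
  by rewrite mulr_suml; apply: eq_bigr => i' _; rewrite scalerAl.
by apply: eq_bigr => l _; rewrite !sumE ab.
Qed.

Section StructureConstants.
Variables (k : fieldType) (p : nat).
Hypothesis pk : p \in [pchar k].
Variable F : formal_group_law k.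

Let Fc (i j : nat) : k := fgl_series F [multinom [tuple i; j]].

(* F(X, Y)^n = sum_(i, j) fgl_pow n i j X^i Y^j *)
Fixpoint fgl_pow (n i j : nat) : k :=
  if n is n'.+1 then
    \sum_(a < i.+1) \sum_(b < j.+1) Fc a b * fgl_pow n' (i - a) (j - b)
  else ((i == 0%N) && (j == 0%N))%:R.

(** F has no constant term, so every monomial of F^n has degree at least n. *)
Lemma fgl_pow_big n i j : (i + j < n)%N -> fgl_pow n i j = 0.
Proof.
elim: n i j => [|n IHn] i j //= ijn; rewrite big1 // => a _; rewrite big1 // => b _.
have [/eqP|ab0] := posnP (a + b).
  rewrite addn_eq0 => /andP[/eqP-> /eqP->].
  by rewrite /Fc fgl_const0 mul0r.
rewrite IHn ?mulr0 //.
have := ltn_ord a; have := ltn_ord b; rewrite !ltnS => bj ai.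
rewrite -ltnS (leq_trans _ ijn) // ltnS -(ltn_add2r (a + b)).
by rewrite addnACA !subnK // -{1}[(i + j)%N]addn0 ltn_add2l.
Qed.

Lemma fgl_truncX e (R : comAlgType k) (x y : R) n :
  x ^+ (p ^ e) = 0 -> y ^+ (p ^ e) = 0 ->
  fgl_trunc p F e x y ^+ n =
  \sum_(i < p ^ e) \sum_(j < p ^ e) fgl_pow n i j *: (x ^+ i * y ^+ j).
Proof.
set q := (p ^ e)%N => xq yq.
have colE (f : nat -> nat -> k) :
    \sum_(i < q) \sum_(j < q) f i j *: (x ^+ i * y ^+ j) =
    \sum_(j < q) (\sum_(i < q) (f i j)%:A * x ^+ i) * y ^+ j.
  rewrite exchange_big; apply: eq_bigr => j _; rewrite mulr_suml.
  by apply: eq_bigr => i _; rewrite mulr_algl scalerAl.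
have q0 : (0 < q)%N := q_gt0 pk e.
rewrite colE; elim: n => [|n IHn].
  rewrite expr0 (bigD1 (Ordinal q0)) //= (bigD1 (Ordinal q0)) //= !eqxx.
  rewrite scale1r !expr0 !mulr1 !big1 ?addr0 // => [j jn0|i in0].
    rewrite big1 ?mul0r // => i _; rewrite -val_eqE /= in jn0.
    by rewrite (negPf jn0) andbF scale0r mul0r.
  by rewrite -val_eqE /= in in0; rewrite (negPf in0) scale0r mul0r.
have FE : fgl_trunc p F e x y =
    \sum_(j < q) (\sum_(i < q) (Fc i j)%:A * x ^+ i) * y ^+ j by rewrite -colE.
rewrite exprS IHn FE (mul_sum_nilp (fun j => \sum_(i < q) (Fc i j)%:A * x ^+ i)
  (fun j => \sum_(i < q) (fgl_pow n i j)%:A * x ^+ i) yq).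
apply: eq_bigr => j _; congr (_ * _).
under eq_bigr => b _ do rewrite (mul_sum_nilp (fun i => (Fc i b)%:A)
  (fun i => (fgl_pow n i (j - b))%:A) xq).
rewrite exchange_big; apply: eq_bigr => i _ /=.
rewrite -mulr_suml exchange_big scaler_suml; congr (_ * _); apply: eq_bigr => a _.
rewrite scaler_suml; apply: eq_bigr => b _.
by rewrite mulr_algl scalerA.
Qed.

Lemma ltn_expp n : (n < p ^ n)%N.
Proof. exact/ltn_expl/prime_gt1/(pcharf_prime pk). Qed.

(** From F(X, 0)^n = X^n; [e] is chosen so that n and i lie below the truncation. *)
Lemma fgl_pow_r0 n i : fgl_pow n i 0%N = (n == i)%:R.
Proof.
pose e := maxn n i; have q0 := q_gt0 pk e.
have [R [X [Xq free]]] := @monomials_free k _ q0.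
have [nq iq] : (n < p ^ e)%N /\ (i < p ^ e)%N.
  by split; apply: leq_ltn_trans (ltn_expp e); rewrite ?leq_maxl ?leq_maxr.
apply: (free (fun i => fgl_pow n i 0%N) (fun i => (n == i)%:R)) => //.
have := fgl_truncX n Xq (expr0q pk e R); rewrite (fgl_truncx0 pk) // => XnE.
transitivity (X ^+ n).
  rewrite XnE; apply: eq_bigr => i' _; rewrite (bigD1 (Ordinal q0)) //= big1.
    by rewrite addr0 expr0 mulr1.
  by move=> j; rewrite -val_eqE /= => /negPf jn0; rewrite expr0n jn0 mulr0 scaler0.
rewrite (bigD1 (Ordinal nq)) //= eqxx scale1r big1 ?addr0 // => i'.
by rewrite -val_eqE /= eq_sym => /negPf->; rewrite scale0r.
Qed.

Lemma fgl_pow_0l n j : fgl_pow n 0%N j = (n == j)%:R.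
Proof.
pose e := maxn n j; have q0 := q_gt0 pk e.
have [R [X [Xq free]]] := @monomials_free k _ q0.
have [nq jq] : (n < p ^ e)%N /\ (j < p ^ e)%N.
  by split; apply: leq_ltn_trans (ltn_expp e); rewrite ?leq_maxl ?leq_maxr.
apply: (free (fun j => fgl_pow n 0%N j) (fun j => (n == j)%:R)) => //.
have := fgl_truncX n (expr0q pk e R) Xq; rewrite (fgl_trunc0x pk) // => XnE.
transitivity (X ^+ n).
  rewrite XnE exchange_big; apply: eq_bigr => j' _; rewrite (bigD1 (Ordinal q0)) //= big1.
    by rewrite addr0 expr0 mul1r.
  by move=> i; rewrite -val_eqE /= => /negPf jn0; rewrite expr0n jn0 mul0r scaler0.
rewrite (bigD1 (Ordinal nq)) //= eqxx scale1r big1 ?addr0 // => j'.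
by rewrite -val_eqE /= eq_sym => /negPf->; rewrite scale0r.
Qed.

(** Compare the coefficients of X^i Y^j Z^l in F(F(X, Y), Z)^n = F(X, F(Y, Z))^n. For the structure
    constants [fgl_pow] this is the associativity [cA]. *)
Lemma fgl_powA n i j l :
  \sum_(m < (i + j).+1) fgl_pow m i j * fgl_pow n m l =
  \sum_(m < (j + l).+1) fgl_pow m j l * fgl_pow n i m.
Proof.
pose e := (i + j + l)%N; have q0 := q_gt0 pk e.
have := ltn_expp e; set q := (p ^ e)%N => eq.
have [R [X [Y [Z [Xq Yq Zq free]]]]] := trivariate_monomials_free k q0.
have ijq : (i + j < q)%N by apply: leq_ltn_trans eq; rewrite leq_addr.
have jlq : (j + l < q)%N by apply: leq_ltn_trans eq; rewrite /e -addnA leq_addl.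
have iq : (i < q)%N by apply: leq_ltn_trans ijq; rewrite leq_addr.
have jq : (j < q)%N by apply: leq_ltn_trans ijq; rewrite leq_addl.
have lq : (l < q)%N by apply: leq_ltn_trans jlq; rewrite leq_addl.
have -> := @c_wide k fgl_pow fgl_pow_big k^o (fun m => fgl_pow n m l) i j q ijq.
have -> := @c_wide k fgl_pow fgl_pow_big k^o (fun m => fgl_pow n i m) j l q jlq.
apply: (free (fun i j l => \sum_(m < q) fgl_pow m i j * fgl_pow n m l)
  (fun i j l => \sum_(m < q) fgl_pow m j l * fgl_pow n i m)) => //.
have XYq := fgl_trunc_nil pk F Xq Yq; have YZq := fgl_trunc_nil pk F Yq Zq.
have := congr1 (fun u => u ^+ n) (fgl_truncA pk F Xq Yq Zq).
rewrite /= (fgl_truncX n XYq Zq) (fgl_truncX n Xq YZq).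
move=> E; transitivity (\sum_(m < q) \sum_(l < q)
    fgl_pow n m l *: (fgl_trunc p F e X Y ^+ m * Z ^+ l)).
  rewrite [RHS]exchange_big; apply: eq_bigr => l' _.
  transitivity (\sum_(j < q) \sum_(i < q) \sum_(m < q)
      (fgl_pow m i j * fgl_pow n m l') *: (X ^+ i * Y ^+ j * Z ^+ l')).
    by do 2![apply: eq_bigr => ? _]; rewrite scaler_suml.
  rewrite exchange_big [RHS](eq_bigr (fun m : 'I_q => \sum_(i < q) \sum_(j < q)
    (fgl_pow m i j * fgl_pow n m l') *: (X ^+ i * Y ^+ j * Z ^+ l'))).
    rewrite [RHS]exchange_big; apply: eq_bigr => i' _.
    by rewrite [RHS]exchange_big.
  move=> m _; rewrite (fgl_truncX m Xq Yq) mulr_suml scaler_sumr; apply: eq_bigr => i' _.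
  rewrite mulr_suml scaler_sumr; apply: eq_bigr => j' _.
  by rewrite -scalerAl scalerA mulrC.
rewrite E.
rewrite [RHS](eq_bigr (fun l' : 'I_q => \sum_(i < q) \sum_(j < q) \sum_(m < q)
    (fgl_pow m j l' * fgl_pow n i m) *: (X ^+ i * Y ^+ j * Z ^+ l'))); last first.
  move=> l' _; rewrite exchange_big; apply: eq_bigr => i' _; apply: eq_bigr => j' _.
  by rewrite scaler_suml.
rewrite [RHS]exchange_big; apply: eq_bigr => i' _.
rewrite [RHS](eq_bigr (fun l' : 'I_q => \sum_(m < q) \sum_(j < q)
    (fgl_pow m j l' * fgl_pow n i' m) *: (X ^+ i' * Y ^+ j * Z ^+ l'))); last first.
  by move=> l' _; rewrite exchange_big.
rewrite [RHS]exchange_big; apply: eq_bigr => m _.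
rewrite (fgl_truncX m Yq Zq) mulr_sumr scaler_sumr [RHS]exchange_big; apply: eq_bigr => j' _.
rewrite mulr_sumr scaler_sumr; apply: eq_bigr => l' _.
by rewrite -scalerAr scalerA mulrA mulrC.
Qed.

End StructureConstants.

(** * Series commuting with Frobenius *)

Section Order.
Variable k : fieldType.
Implicit Types P Q : {poly k}.

Lemma dvdXnP n P : reflect (forall i, (i < n)%N -> P`_i = 0) ('X^n %| P).
Proof.
apply: (iffP idP) => [/dvdpP[Q ->] i ni|P0]; first by rewrite coefMXn ni.
rewrite -[P](poly_take_drop n) addrC dvdp_addr ?dvdp_mull //.
rewrite (_ : take_poly n P = 0) ?dvdp0 //; apply/polyP => i.
by rewrite coef_take_poly coef0; case: ifP => // /P0.
Qed.

Definition has_order P n := (forall i, (i < n)%N -> P`_i = 0) /\ P`_n != 0.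

Lemma has_orderP P n : has_order P n <-> exists2 Q, P = 'X^n * Q & Q`_0 != 0.
Proof.
split=> [[/dvdXnP/dvdpP[Q ->]]|[Q -> Q0]].
  by rewrite coefMXn ltnn subnn => Q0; exists Q; rewrite // mulrC.
split=> [i ni|]; first by rewrite coefXnM ni.
by rewrite coefXnM ltnn subnn.
Qed.

Lemma has_order_ex P i : P`_i != 0 ->
  exists n, [/\ (n <= i)%N & has_order P n].
Proof.
move=> Pi; have ex : exists n, P`_n != 0 by exists i.
case: (ex_minnP ex) => n Pn nmin; exists n; split; first exact: nmin.
by split=> // j jn; apply: contraTeq jn => /nmin; rewrite leqNgt.
Qed.

Lemma has_orderM P Q a b : has_order P a -> has_order Q b ->
  has_order (P * Q) (a + b).
Proof.
move=> /has_orderP[P' -> P0] /has_orderP[Q' -> Q0].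
apply/has_orderP; exists (P' * Q'); first by rewrite exprD; ring.
by rewrite coefM big_ord1 subnn mulf_neq0.
Qed.

Lemma has_orderX P a n : has_order P a -> has_order (P ^+ n) (a * n).
Proof.
move=> Pa; elim: n => [|n IHn]; last by rewrite exprS mulnS; apply: has_orderM.
by rewrite expr0 muln0; split=> //; rewrite coef1 oner_eq0.
Qed.

Lemma has_order_comp P Q a b : (0 < b)%N -> has_order P a -> has_order Q b ->
  has_order (P \Po Q) (a * b).
Proof.
move=> b0 /has_orderP[P' -> P0] Qb.
rewrite comp_polyM rmorphXn /= comp_polyX mulnC -[(b * a)%N]addn0.
apply: has_orderM; first exact: has_orderX.
split=> //; rewrite -horner_coef0 horner_comp [Q.[0]]horner_coef0.
by rewrite (proj1 Qb) // horner_coef0.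
Qed.

Lemma has_order_mod P Q a b n : has_order P a -> has_order Q b ->
  (a < n)%N -> (b < n)%N -> 'X^n %| P - Q -> a = b.
Proof.
move=> [Pl Pa] [Ql Qb] an bn /dvdXnP H.
have E i : (i < n)%N -> P`_i = Q`_i.
  by move/H; rewrite coefB => /eqP; rewrite subr_eq0 => /eqP.
case: (ltngtP a b) => // ab.
  by rewrite E // Ql // eqxx in Pa.
by rewrite -E // Pl // eqxx in Qb.
Qed.

Lemma dvdXn_comp n P P' Q : Q`_0 = 0 -> 'X^n %| P - P' -> 'X^n %| (P \Po Q) - (P' \Po Q).
Proof.
move=> Q0 /dvdpP[U UE]; rewrite -comp_polyB UE comp_polyM rmorphXn /= comp_polyX dvdp_mull //.
by rewrite dvdp_exp2r // -[ 'X]expr1; apply/dvdXnP => -[].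
Qed.

Lemma dvdp_subX (P Q : {poly k}) n : P - Q %| P ^+ n - Q ^+ n.
Proof. by rewrite subrXX dvdp_mulr. Qed.

Lemma dvdp_comp_sub P Q Q' : Q - Q' %| (P \Po Q) - (P \Po Q').
Proof.
rewrite !comp_polyE -sumrB; apply: (big_ind (fun U => Q - Q' %| U)) => [|U V HU HV|i _].
- exact: dvdp0.
- exact: dvdp_add.
- by rewrite -scalerBr -mul_polyC dvdp_mull // dvdp_subX.
Qed.

End Order.

Lemma poly_exp_pchar (R : comNzRingType) (p : nat) (pR : p \in [pchar R])
    (P : {poly R}) :
  P ^+ p = map_poly (pFrobenius_aut pR) P \Po 'X^p.
Proof.
have pP : p \in [pchar {poly R}] := rmorph_pchar (@polyC R) pR.
elim/poly_ind: P => [|P c IHP].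
  by rewrite rmorph0 comp_poly0 expr0n gtn_eqF ?prime_gt0 ?(pcharf_prime pR).
rewrite [LHS](rmorphD (pFrobenius_aut pP)) /= !pFrobenius_autE exprMn IHP.
rewrite rmorphD rmorphM /= map_polyX map_polyC.
by rewrite comp_polyD comp_polyM comp_polyX comp_polyC -polyC_exp.
Qed.

Lemma coef_exp_pchar (R : comNzRingType) (p : nat) (pR : p \in [pchar R])
    (P : {poly R}) i :
  (P ^+ p)`_i = if (p %| i)%N then P`_(i %/ p) ^+ p else 0.
Proof.
rewrite (poly_exp_pchar pR) coef_comp_poly_Xn ?prime_gt0 ?(pcharf_prime pR) //.
by rewrite coef_map; case: ifP.
Qed.

Section FrobeniusSeries.
Variables (k : fieldType) (p : nat).
Hypothesis pk : p \in [pchar k].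
Hypothesis k_perfect : forall x : k, exists y : k, y ^+ p = x.
Variable Q : nat -> k.
Hypothesis Q0 : Q 0%N = 0.

Let p_prime : prime p := pcharf_prime pk.
Let p_gt0 : (0 < p)%N := prime_gt0 p_prime.

Let pP : p \in [pchar {poly k}].
Proof. by rewrite pchar_lalg. Qed.

Let ltn_expp n : (n < p ^ n)%N := ltn_expl n (prime_gt1 p_prime).

Lemma polyB_exp (P S : {poly k}) : (P - S) ^+ p = P ^+ p - S ^+ p.
Proof. exact: (rmorphB (pFrobenius_aut pP)). Qed.

Lemma polyD_exp (P S : {poly k}) : (P + S) ^+ p = P ^+ p + S ^+ p.
Proof. exact: (rmorphD (pFrobenius_aut pP)). Qed.

Local Notation pol n f := (\poly_(i < n) f i).

(* sigma (Q (X)) = sigma (X) ^ p *)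
Definition frobenius_series (sigma : nat -> k) :=
  forall e, let q := (p ^ e)%N in 'X^q %| (pol q sigma \Po pol q Q) - pol q sigma ^+ p.

Lemma coef_pol n (f : nat -> k) i : (i < n)%N -> (pol n f)`_i = f i.
Proof. by rewrite coef_poly => ->. Qed.

Lemma has_order_pol n (f : nat -> k) a : (a < n)%N ->
  (forall i, (i < a)%N -> f i = 0) -> f a != 0 -> has_order (pol n f) a.
Proof.
move=> an fa0 fa; split=> [i ia|]; rewrite coef_pol //; first exact: fa0.
exact: ltn_trans ia an.
Qed.

(** Constant terms cancel, as sigma(0) = sigma(0)^p. If the rest of sigma has order r and Q has
    order t, the two sides have orders r t and r p, so t = p. *)
Lemma frobenius_series_order sigma : frobenius_series sigma ->
  (exists2 n, (0 < n)%N & sigma n != 0) ->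
  (forall i, (i < p)%N -> Q i = 0) /\ Q p != 0.
Proof.
move=> H [n n_gt0 sn].
have ex : exists n, (0 < n)%N && (sigma n != 0) by exists n; rewrite n_gt0.
case: (ex_minnP ex) => r /andP[r_gt0 sr] rmin.
pose tau n := if n == 0%N then 0 else sigma n.
have tau_r : tau r != 0 by rewrite /tau gtn_eqF.
have tau_lt i : (i < r)%N -> tau i = 0.
  move=> ir; rewrite /tau; case: posnP => // i0; apply/eqP; apply: contraTT ir => si.
  by rewrite -leqNgt rmin // i0.
have sE q : (0 < q)%N -> pol q sigma = pol q tau + (sigma 0%N)%:P.
  move=> q0; apply/polyP => i; rewrite coefD coefC !coef_poly /tau.
  by case: eqP => [->|_]; rewrite ?q0 ?add0r ?addr0.
have pol0 q (f : nat -> k) : (0 < q)%N -> (pol q f)`_0 = f 0%N by apply: coef_pol.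
have H' e : 'X^(p ^ e) %| (pol (p ^ e) tau \Po pol (p ^ e) Q) - pol (p ^ e) tau ^+ p.
  have q0 : (0 < p ^ e)%N by rewrite expn_gt0 p_gt0.
  have := H e; rewrite /= sE // comp_polyD comp_polyC polyD_exp.
  set A := _ \Po _; set B := _ ^+ p; set c := _%:P.
  have -> : A + c - (B + c ^+ p) = A - B + (c - c ^+ p) by ring.
  move=> D; have : (A - B + (c - c ^+ p))`_0 = 0 by apply: (dvdXnP _ _ D).
  have A0 : A`_0 = 0.
    rewrite -horner_coef0 horner_comp horner_coef0 pol0 // Q0 horner_coef0 pol0 //.
  have B0 : B`_0 = 0.
    by rewrite -horner_coef0 horner_exp horner_coef0 pol0 // expr0n (gtn_eqF p_gt0).
  rewrite coefD coefB A0 B0 subrr add0r /c -polyC_exp -polyCB coefC /= => c0.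
  by move: D; rewrite /c -polyC_exp -polyCB c0 addr0.
have tau_ord q : (r < q)%N -> has_order (pol q tau) r.
  by move=> rq; apply: has_order_pol.
(* With Q = 0, the p-th power of the nonzero series tau would vanish. *)
have [t Qt] : exists t, Q t != 0.
  apply: contrapT => Qn0; pose e := (r * p)%N.
  have re : (r < p ^ e)%N.
    by apply: leq_ltn_trans (ltn_expp e); rewrite leq_pmulr.
  have := H' e; rewrite (_ : pol _ Q = 0); last first.
    apply/polyP => i; rewrite coef_poly coef0; case: ifP => // _.
    by apply: contrapT => Qi; apply: Qn0; exists i; apply/eqP.
  rewrite comp_poly0r pol0 ?expn_gt0 ?p_gt0 // /tau eqxx polyC0 sub0r dvdpNr.
  have [_ ne] := has_orderX p (tau_ord _ re).
  by move/dvdXnP/(_ (r * p)%N (ltn_expp _)) => e0; rewrite e0 eqxx in ne.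
have exQ : exists t, Q t != 0 by exists t.
case: (ex_minnP exQ) => {Qt}t Qt tmin.
have t_gt0 : (0 < t)%N by case: (t) Qt => //; rewrite Q0 eqxx.
have Qlt i : (i < t)%N -> Q i = 0.
  by move=> it; apply: contraTeq it => /tmin; rewrite -leqNgt.
suff <- : t = p by [].
(* [e] bounds every order that occurs, and e < p^e puts them all below the truncation, where a
   congruence modulo X^(p^e) still detects them. *)
pose e := (r * p + r * t + t + r)%N.
have lt n' : (n' <= e)%N -> (n' < p ^ e)%N by move=> ne; apply: leq_ltn_trans (ltn_expp e).
have re : (r < p ^ e)%N by apply: lt; rewrite leq_addl.
have te : (t < p ^ e)%N by apply: lt; rewrite /e; lia.
have := has_order_mod (has_order_comp t_gt0 (tau_ord _ re) (has_order_pol te Qlt Qt))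
  (has_orderX p (tau_ord _ re)) _ _ (H' e).
move/(_ _ _)/eqP; rewrite eqn_pmul2l // => E; apply/eqP/E; apply: lt.
  by rewrite /e; lia.
by rewrite /e; lia.
Qed.

(** Differentiate: sigma^p has derivative 0, so sigma'(Q) Q' = 0. The index n makes sigma' nonzero,
    and some Q_j nonzero with j prime to p would make Q' nonzero. *)
Lemma frobenius_series_deriv sigma n : frobenius_series sigma ->
  ~~ (p %| n)%N -> sigma n != 0 -> forall j, ~~ (p %| j)%N -> Q j = 0.
Proof.
move=> H pn sn j pj; apply/eqP; apply: contraT => Qj.
have n_gt0 : (0 < n)%N by case: (n) pn => //; rewrite dvdn0.
have j_gt0 : (0 < j)%N by case: (j) pj => //; rewrite dvdn0.
have [Qlt Qp] := frobenius_series_order H (ex_intro2 _ _ n n_gt0 sn).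
have p0 i : ~~ (p %| i)%N -> (i%:R : k) != 0 by rewrite (dvdn_pcharf pk).
pose e := (n * p + j + 2 + p + n)%N.
have lt m : (m <= e)%N -> (m < p ^ e)%N by move=> me; apply: leq_ltn_trans (ltn_expp e).
have pe : (p < p ^ e)%N by apply: lt; rewrite /e; lia.
have ne : (n < p ^ e)%N by apply: lt; rewrite leq_addl.
have je : (j < p ^ e)%N by apply: lt; rewrite /e; lia.
have [s [sn' s_ord]] : exists s, (s <= n.-1)%N /\ has_order (pol (p ^ e) sigma)^`() s.
  have /has_order_ex[s [ss so]] : (pol (p ^ e) sigma)^`()`_n.-1 != 0.
    by rewrite coef_deriv prednK // coef_pol // -mulr_natr mulf_neq0 // p0.
  by exists s.
have [w [wj w_ord]] : exists w, (w <= j.-1)%N /\ has_order (pol (p ^ e) Q)^`() w.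
  have /has_order_ex[w [ww wo]] : (pol (p ^ e) Q)^`()`_j.-1 != 0.
    by rewrite coef_deriv prednK // coef_pol // -mulr_natr mulf_neq0 // p0.
  by exists w.
have := has_orderM (has_order_comp p_gt0 s_ord (has_order_pol pe Qlt Qp)) w_ord.
rewrite -deriv_comp.
have -> : ((pol (p ^ e) sigma) \Po (pol (p ^ e) Q))^`() =
    ((pol (p ^ e) sigma \Po pol (p ^ e) Q) - pol (p ^ e) sigma ^+ p)^`().
  by rewrite derivB deriv_exp -[_ *+ p]mulr_natr (pcharf0 pP) mulr0 subr0.
move=> [_]; rewrite coef_deriv.
(* The successor accounts for the index lost by differentiation. *)
have lt_e : ((s * p + w).+1 < p ^ e)%N.
  have snp : (s * p <= n * p)%N by rewrite leq_mul2r (leq_trans sn') ?leq_pred ?orbT.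
  by apply: lt; rewrite /e; lia.
by rewrite (dvdXnP _ _ (H e)) ?mul0rn ?eqxx.
Qed.

(** Here sigma = tau^p, where perfectness supplies the coefficients of tau, and (tau(Q) - tau^p)^p =
    sigma(Q) - sigma^p. Divisibility by X^(q p) thus descends to X^q: level [e.+1] of sigma gives
    level [e] of tau. *)
Lemma frobenius_series_root sigma : frobenius_series sigma ->
  (forall n, ~~ (p %| n)%N -> sigma n = 0) ->
  exists tau, frobenius_series tau /\ forall n, tau n ^+ p = sigma (p * n)%N.
Proof.
move=> H s0; have [tau tauE] := choice (fun n => k_perfect (sigma (p * n)%N)).
exists tau; split=> // e /=; set q := (p ^ e)%N.
have polE : pol (p ^ e.+1) sigma = pol q tau ^+ p.
  apply/polyP => i; rewrite (coef_exp_pchar pk) !coef_poly expnSr -/q.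
  have [/dvdnP[j ->]|/s0->] := boolP (p %| i)%N; last by rewrite if_same.
  rewrite mulnK // ltn_pmul2r // mulnC -tauE.
  by case: ifP => // _; rewrite expr0n (gtn_eqF p_gt0).
have := H e.+1; rewrite /= polE rmorphXn /= -polyB_exp expnSr -/q exprM.
rewrite dvdp_pexp2r // => D.
rewrite -[pol q tau \Po _](subrK (pol q tau \Po pol (q * p) Q)) -addrA.
rewrite dvdp_addl //; apply: dvdp_trans (dvdp_comp_sub _ _ _).
apply/dvdXnP => j jq; rewrite coefB !coef_poly jq ifT ?subrr //.
by rewrite (leq_trans jq) ?leq_pmulr.
Qed.

(** Descent on the index n of a nonzero coefficient: either some nonzero coefficient has index prime
    to p and differentiation applies, or passing to the p-th root divides n by p. *)
Lemma frobenius_series_pth_power sigma : frobenius_series sigma ->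
  (exists2 n, (0 < n)%N & sigma n != 0) -> forall j, ~~ (p %| j)%N -> Q j = 0.
Proof.
move=> H [n n_gt0 sn]; elim/ltn_ind: n => n IHn in sigma H n_gt0 sn *.
have [[m [pm sm]]|all0] := pselect (exists m, ~~ (p %| m)%N /\ sigma m != 0).
  exact: frobenius_series_deriv H pm sm.
have s0 m : ~~ (p %| m)%N -> sigma m = 0.
  by move=> pm; apply/eqP; apply: contrapT => /negP sm; apply: all0; exists m.
have [tau [Htau tauE]] := frobenius_series_root H s0.
have /dvdnP[m nE] : (p %| n)%N by apply: contraNT sn => /s0->.
have m_gt0 : (0 < m)%N by case: (m) nE n_gt0 => // ->.
apply: (IHn m _ tau Htau m_gt0).
  by rewrite nE ltn_Pmulr ?(prime_gt1 p_prime).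
by apply: contraNneq sn => tm; rewrite nE mulnC -tauE tm expr0n (gtn_eqF p_gt0).
Qed.

End FrobeniusSeries.

(** * Matrix representations of F *)

Lemma poly_mod_Xn (k : fieldType) q : (0 < q)%N ->
  exists (R : comAlgType k) (pi : {rmorphism {poly k} -> R}),
    (forall c, pi c%:P = c%:A) /\ (forall P, pi P = 0 <-> 'X^q %| P).
Proof.
move=> q_gt0.
have [|||R [pi [_ piI pik]]] := @quotient_algebra k _ (@polyC k) (fun P => is_true ('X^q %| P)).
- exact: dvdp0.
- by move/dvdXnP/(_ 0%N q_gt0)/eqP; rewrite coef1 oner_eq0.
- by move=> a u v Iu Iv; rewrite dvdp_add ?dvdp_mull.
by exists R, pi.
Qed.

(** The scalar matrix X commutes with A, so (X - A)^p = X^p - A^p in characteristic p. Determinants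
    give chi_A(X)^p = chi_B(X^p) with B = A^p, and degree i p is compared. *)
Lemma char_poly_exp_pchar (k : fieldType) (p : nat) (pk : p \in [pchar k]) d
    (A : 'M[{poly k}]_d.+1) i :
  (char_poly (A ^+ p))`_i = (char_poly A)`_i ^+ p.
Proof.
have p_prime := pcharf_prime pk.
have p_gt0 := prime_gt0 p_prime.
have pP : p \in [pchar {poly k}] := rmorph_pchar (@polyC k) pk.
have pPP : p \in [pchar {poly {poly k}}] := rmorph_pchar (@polyC {poly k}) pP.
have pM : p \in [pchar 'M[{poly {poly k}}]_d.+1].
  exact: (rmorph_pchar (@scalar_mx _ d.+1) pPP).
have E : char_poly_mx A ^+ p = map_mx (comp_poly 'X^p) (char_poly_mx (A ^+ p)).
  have comXA : GRing.comm ('X%:M : 'M[{poly {poly k}}]_d.+1) (map_mx polyC A).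
    exact/esym/scalar_mxC.
  rewrite /char_poly_mx -(pFrobenius_autE pM) pFrobenius_autB_comm //.
  rewrite !pFrobenius_autE -rmorphXn -rmorphXn map_mxB map_scalar_mx /= comp_polyX.
  congr (_ - _).
  by apply/matrixP => a b; rewrite !mxE comp_polyC.
have detX n : \det (char_poly_mx A ^+ n) = char_poly A ^+ n.
  by elim: n => [|n IHn]; rewrite ?det1 // !exprS det_mulmx IHn.
have E2 : char_poly A ^+ p = char_poly (A ^+ p) \Po 'X^p.
  by rewrite -detX E det_map_mx.
have := coef_exp_pchar pP (char_poly A) (i * p).
rewrite E2 (coef_comp_poly_Xn _ (i * p) p_gt0) (dvdn_mull i (dvdnn p)).
by rewrite (mulnK i p_gt0).
Qed.

Section MatrixRepresentation.
Variables (k : fieldType) (p : nat).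
Hypothesis pk : p \in [pchar k].
Variable F : formal_group_law k.
Variables (d : nat) (M : nat -> 'M[k]_d.+1).
Hypothesis k_perfect : forall x : k, exists y : k, y ^+ p = x.
Hypothesis M0 : M 0%N = 1%:M.
Hypothesis MM : forall i j,
  M i *m M j = \sum_(n < (i + j).+1) fgl_pow F n i j *: M n.

(** If x^q = y^q = 0 then F(x, y)^q = 0. This removes the indices from q to i + j, which occur in
    [MM] when i + j >= q although i and j are below q. *)
Lemma fgl_pow_ge e n i j : (i < p ^ e)%N -> (j < p ^ e)%N -> (p ^ e <= n)%N ->
  fgl_pow F n i j = 0.
Proof.
move=> iq jq qn; have q0 := q_gt0 pk e.
have [R [X [Y [Xq Yq free]]]] := bivariate_monomials_free k q0.
apply: (free (fun i j => fgl_pow F n i j) (fun i j => 0)) iq jq.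
rewrite -(fgl_truncX pk) // -(subnKC qn) exprD fgl_trunc_nil // mul0r.
by rewrite big1 // => i' _; rewrite big1 // => j' _; rewrite scale0r.
Qed.

Lemma MM_wide e i j : (i < p ^ e)%N -> (j < p ^ e)%N ->
  M i *m M j = \sum_(n < p ^ e) fgl_pow F n i j *: M n.
Proof.
move=> iq jq; rewrite MM; have [ijq|qij] := ltnP (i + j) (p ^ e).
  exact: (c_wide (fgl_pow_big F)).
rewrite -!(big_mkord xpredT (fun n => fgl_pow F n i j *: M n)).
rewrite (big_cat_nat (leq0n (p ^ e))) /=; last exact: leqW.
rewrite [X in _ + X]big1_seq ?addr0 // => n.
rewrite mem_index_iota => /andP[_ /andP[qn _]].
by rewrite (fgl_pow_ge iq jq qn) scale0r.
Qed.

Definition rep e (R : comAlgType k) (x : R) : 'M[R]_d.+1 :=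
  \sum_(i < p ^ e) x ^+ i *: map_mx (in_alg R) (M i).

Lemma rep0 e (R : comAlgType k) : rep e (0 : R) = 1.
Proof.
rewrite /rep (bigD1 (Ordinal (q_gt0 pk e))) //= big1 ?addr0 => [|i].
  by rewrite expr0 scale1r M0 map_mx1.
by rewrite -val_eqE /= => /negPf i0; rewrite expr0n i0 scale0r.
Qed.

Lemma repM e (R : comAlgType k) (x y : R) :
  x ^+ (p ^ e) = 0 -> y ^+ (p ^ e) = 0 ->
  rep e x * rep e y = rep e (fgl_trunc p F e x y).
Proof.
move=> xq yq; rewrite /rep -[LHS]/(_ *m _).
transitivity (\sum_(i < p ^ e) \sum_(j < p ^ e) \sum_(n < p ^ e)
    (fgl_pow F n i j *: (x ^+ i * y ^+ j)) *: map_mx (in_alg R) (M n)).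
  rewrite mulmx_suml; apply: eq_bigr => i _; rewrite mulmx_sumr; apply: eq_bigr => j _.
  rewrite -scalemxAl -scalemxAr scalerA -map_mxM (MM_wide (ltn_ord i) (ltn_ord j)).
  rewrite raddf_sum scaler_sumr; apply: eq_bigr => n _ /=.
  by rewrite map_mxZ scalerA mulr_algr.
under eq_bigr do rewrite exchange_big.
rewrite exchange_big; apply: eq_bigr => n _ /=.
rewrite (fgl_truncX pk) // scaler_suml; apply: eq_bigr => i _.
by rewrite scaler_suml.
Qed.

Lemma rep_nmul e (R : comAlgType k) (x : R) n : x ^+ (p ^ e) = 0 ->
  rep e x ^+ n = rep e (iter n (fgl_trunc p F e x) 0).
Proof.
move=> xq; elim: n => [|n IHn]; first by rewrite rep0 expr0.
rewrite exprS IHn repM //.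
by have [_] := ps_eval_nmul pk F n xq.
Qed.

Let Q (i : nat) : k := ps_coef (fgl_nmul F p) i.
Local Notation pol n f := (\poly_(i < n) f i).

Lemma ps_coef_nmul0 : Q 0%N = 0.
Proof.
rewrite /Q /ps_coef mulm0n; case: (p) => [|n] /=; first by rewrite /ps_of_mpoly mcoeff0.
by rewrite ps_comp_const fgl_series_const.
Qed.

Definition rep_poly q : 'M[{poly k}]_d.+1 := \matrix_(a, b) \poly_(i < q) M i a b.

Section Quotient.
Variables (e : nat) (R : comAlgType k) (pi : {rmorphism {poly k} -> R}).
Hypothesis pik : forall c, pi c%:P = c%:A.
Hypothesis piI : forall P, pi P = 0 <-> 'X^(p ^ e) %| P.

Lemma pi_comp_poly (f : nat -> k) q P :
  pi (pol q f \Po P) = \sum_(i < q) f i *: pi P ^+ i.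
Proof.
rewrite poly_def rmorph_sum rmorph_sum; apply: eq_bigr => i _ /=.
rewrite comp_polyZ rmorphXn /= comp_polyX -mul_polyC rmorphM rmorphXn pik.
by rewrite mulr_algl.
Qed.

Lemma pi_nil (P : {poly k}) : P`_0 = 0 -> pi P ^+ (p ^ e) = 0.
Proof.
move=> P0; rewrite -rmorphXn; apply/piI/dvdp_exp2r.
by rewrite -['X]expr1; apply/dvdXnP => -[].
Qed.

Lemma rep_pi (P : {poly k}) : rep e (pi P) = map_mx pi (map_mx (comp_poly P) (rep_poly (p ^ e))).
Proof.
apply/matrixP => a b; rewrite !mxE summxE pi_comp_poly; apply: eq_bigr => i _.
by rewrite !mxE mulr_algr.
Qed.

Lemma rep_piX : rep e (pi 'X) = map_mx pi (rep_poly (p ^ e)).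
Proof.
rewrite rep_pi; congr (map_mx _ _); apply/matrixP => a b.
by rewrite !mxE comp_polyXr.
Qed.

Lemma rep_pi_exp (P : {poly k}) : P`_0 = 0 ->
  rep e (pi P) ^+ p = rep e (pi (pol (p ^ e) Q \Po P)).
Proof.
move=> P0; have xq := pi_nil P0; rewrite rep_nmul //.
have [<- _] := ps_eval_nmul pk F p xq.
by rewrite ps_eval1 // pi_comp_poly.
Qed.

End Quotient.

Lemma pi_eq e (R : comAlgType k) (pi : {rmorphism {poly k} -> R}) (P S : {poly k}) :
  (forall P, pi P = 0 <-> 'X^(p ^ e) %| P) ->
  pi P = pi S <-> 'X^(p ^ e) %| P - S.
Proof.
move=> piI; rewrite -piI rmorphB; split=> [->|/eqP]; first by rewrite subrr.
by rewrite subr_eq0 => /eqP.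
Qed.

(** The i-th coefficient of the characteristic polynomial of M(X) is a series in X; its n-th
    coefficient is already determined by M(X) modulo X^(n + 1). *)
Definition char_series i n : k := ((char_poly (rep_poly n.+1))`_i)`_n.

Lemma char_series_mod q i n : (n < q)%N ->
  ((char_poly (rep_poly q))`_i)`_n = char_series i n.
Proof.
move=> nq; have [R [pi [_ piI]]] := @poly_mod_Xn k n.+1 isT.
have E : map_mx pi (rep_poly q) = map_mx pi (rep_poly n.+1).
  apply/matrixP => a b; rewrite !mxE; apply/subr0_eq; rewrite -rmorphB.
  apply/piI/dvdXnP => j jn; rewrite coefB !coef_poly jn ifT ?subrr //.
  exact: leq_trans jn nq.
have : pi ((char_poly (rep_poly q))`_i - (char_poly (rep_poly n.+1))`_i) = 0.
  have cE N : pi (char_poly (rep_poly N))`_i = (char_poly (map_mx pi (rep_poly N)))`_i.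
    by rewrite -map_char_poly coef_map.
  apply/eqP; rewrite rmorphB subr_eq0; apply/eqP.
  by rewrite [LHS]cE [RHS]cE E.
by move/piI/dvdXnP/(_ n (ltnSn n)); rewrite coefB => /subr0_eq.
Qed.

Lemma char_series_frobenius i : frobenius_series p Q (char_series i).
Proof.
move=> e /=; set q := (p ^ e)%N.
have [R [pi [pik piI]]] := @poly_mod_Xn k q (q_gt0 pk e).
pose S := (char_poly (rep_poly q))`_i.
have sS : 'X^q %| pol q (char_series i) - S.
  by apply/dvdXnP => n nq; rewrite coefB coef_poly nq char_series_mod // subrr.
have Q0 : (pol q Q)`_0 = 0 by rewrite coef_poly ps_coef_nmul0 if_same.
apply/(pi_eq (e := e)) => //.
transitivity (pi (S \Po pol q Q)); first by apply/(pi_eq (e := e)) => //; apply: dvdXn_comp.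
transitivity (pi (S ^+ p)); last first.
  by apply/(pi_eq (e := e)) => //; apply: dvdp_trans (dvdp_subX _ _ _); rewrite -dvdpNr opprB.
rewrite /S -(coef_map (comp_poly (pol q Q))) map_char_poly -(coef_map pi) map_char_poly.
rewrite -(rep_pi e pik) -[pol q Q]comp_polyXr.
rewrite -(rep_pi_exp (e := e) pik piI) ?coefX // (rep_piX e pik).
have -> : map_mx pi (rep_poly q) ^+ p = map_mx pi (rep_poly q ^+ p).
  by rewrite -(rmorphXn (map_mx pi)).
rewrite -map_char_poly coef_map; apply: (congr1 pi).
exact: (char_poly_exp_pchar pk).
Qed.

Lemma char_poly1 (R : comNzRingType) n : char_poly (1%:M : 'M[R]_n) = ('X - 1) ^+ n.
Proof.
by rewrite /char_poly /char_poly_mx map_scalar_mx -(raddfB (@scalar_mx _ n)) det_scalar.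
Qed.

Hypothesis M_neq0 : exists2 n, (0 < n)%N & M n != 0.

(* If the characteristic polynomial is constant then M(X) is unipotent, hence of
   finite p-power order, so some iterate of [p]_F vanishes. *)
Lemma constant_char_series : (forall i n, (0 < n)%N -> char_series i n = 0) ->
  forall t, Q t = 0.
Proof.
move=> s0; apply: contrapT => Qn0.
have exQ : exists t, Q t != 0.
  apply: contrapT => H; apply: Qn0 => t; apply/eqP; apply: contrapT => /negP Qt.
  by apply: H; exists t.
case: (ex_minnP exQ) => t Qt tmin.
have t_gt0 : (0 < t)%N by case: (t) Qt => //; rewrite ps_coef_nmul0 eqxx.
have Qlt i : (i < t)%N -> Q i = 0.
  by move=> it; apply: contraTeq it => /tmin; rewrite -leqNgt.
have exM : exists n, (0 < n)%N && (M n != 0).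
  by have [n n0 Mn] := M_neq0; exists n; rewrite n0.
case: (ex_minnP exM) => n /andP[n_gt0 Mn] nmin.
have Mlt i : (0 < i < n)%N -> M i = 0.
  move=> /andP[i0 ilt]; apply: contraTeq ilt => Mi; rewrite -leqNgt.
  by apply: nmin; rewrite i0.
have [a [b Mab]] : exists a b, M n a b != 0.
  apply: contrapT => H; case/eqP: Mn; apply/matrixP => a b; rewrite mxE.
  by apply: contrapT => /eqP Mab; apply: H; exists a, b.
(* K is the size of the matrices: (A - 1)^K = 0 and K < p^K will give A^(p^K) = 1. The choice of [e]
   puts n t^K, the order behind the final contradiction, below p^e. *)
pose K := d.+1; pose e := (n * t ^ K + t + n)%N.
have lt m : (m <= e)%N -> (m < p ^ e)%N.
  by move=> me; apply: leq_ltn_trans (ltn_expp pk e).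
set q := (p ^ e)%N in lt.
have [R [pi [pik piI]]] := @poly_mod_Xn k q (q_gt0 pk e).
pose A := rep e (pi 'X).
have AE : A = map_mx pi (rep_poly q) by apply: rep_piX.
have charA : char_poly A = ('X - 1) ^+ d.+1.
  rewrite -char_poly1; apply/polyP => i.
  rewrite AE -map_char_poly coef_map /=.
  set S := (char_poly _)`_i.
  (* A constant coefficient equals its value at X = 0, where the matrix is M(0) = 1. *)
  have SE : pi S = pi (S`_0)%:P.
    apply/(pi_eq (e := e)) => //; apply/dvdXnP => -[|m] mq; rewrite coefB coefC ?subrr //=.
    by rewrite subr0 char_series_mod // s0.
  have S0 : S`_0 = (char_poly (1%:M : 'M[k]_d.+1))`_i.
    rewrite -horner_coef0 -[S.[0]]/(horner_eval 0 S) /S -(coef_map (horner_eval 0)) map_char_poly.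
    congr ((char_poly _)`_i); rewrite -M0; apply/matrixP => x y.
    by rewrite !mxE -[LHS]/((pol q (fun i => M i x y)).[0]) horner_coef0 coef_poly (q_gt0 pk).
  have CE : (char_poly (1%:M : 'M[R]_d.+1))`_i =
      in_alg R (char_poly (1%:M : 'M[k]_d.+1))`_i.
    by rewrite -(coef_map (in_alg R)) map_char_poly map_mx1.
  by rewrite SE pik S0 CE.
have AK : (A - 1) ^+ d.+1 = 0.
  have := Cayley_Hamilton A; rewrite charA rmorphXn rmorphB /= horner_mx_X.
  by rewrite rmorph1.
have pM : p \in [pchar 'M[R]_d.+1].
  by apply: (rmorph_pchar (@scalar_mx _ d.+1)); rewrite pchar_lalg.
have frobA j : (A - 1) ^+ (p ^ j) = A ^+ (p ^ j) - 1.
  elim: j => [|j IHj]; first by rewrite expn0 !expr1.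
  rewrite expnSr !exprM IHj -!(pFrobenius_autE pM) pFrobenius_autB_comm ?pFrobenius_aut1 //.
  exact: commr1.
have A1 : A ^+ (p ^ K) = 1.
  apply/subr0_eq; rewrite -frobA -(subnKC (ltnW (ltn_expp pk K))) exprD AK.
  by rewrite mul0r.
(* [P j] is the j-th iterate of [p]_F, truncated at each stage; it has order t^j and satisfies
   M(P_j) = M(X)^(p^j) modulo X^q. *)
pose P := fix P j := if j is j'.+1 then pol q Q \Po P j' else 'X.
have PE j : has_order (P j) (t ^ j) /\ rep e (pi (P j)) = A ^+ (p ^ j).
  elim: j => [|j [IHo IHr]] /=.
    rewrite !expn0 expr1; split=> //; split=> [i|]; rewrite coefX ?oner_eq0 //.
    by case: i.
  have Pj0 : (P j)`_0 = 0 by apply: (proj1 IHo); rewrite expn_gt0 t_gt0.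
  rewrite -(rep_pi_exp (e := e) pik piI Pj0) IHr [(p ^ j.+1)%N]expnSr exprM; split=> //.
  rewrite expnS; apply: has_order_comp IHo; first by rewrite expn_gt0 t_gt0.
  by apply: has_order_pol => //; apply: lt; rewrite /e; lia.
have [PK_ord PK] := PE K.
pose tail i := if i == 0%N then 0 else M i a b.
have tail_ord : has_order (pol q tail) n.
  apply: has_order_pol; first by apply: lt; rewrite /e; lia.
    move=> i ilt; rewrite /tail; case: posnP => // i0.
    by rewrite Mlt ?i0 // mxE.
  by rewrite /tail gtn_eqF.
have tK_gt0 : (0 < t ^ K)%N by rewrite expn_gt0 t_gt0.
have := has_order_comp tK_gt0 tail_ord PK_ord.
(* M(P_K) = A^(p^K) = 1 makes tail(P_K) vanish modulo X^q, although its order n t^K is below q. *)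
suff /dvdXnP H : 'X^q %| pol q tail \Po P K.
  by move=> [_]; rewrite H ?eqxx //; apply: lt; rewrite /e; lia.
apply/piI; move: PK; rewrite A1 rep_pi // => /matrixP/(_ a b).
rewrite !mxE => E.
have polE : pol q (fun i => M i a b) = pol q tail + (M 0%N a b)%:P.
  apply/polyP => i; rewrite coefD coefC !coef_poly /tail.
  by case: eqP => [->|_]; rewrite ?(q_gt0 pk) ?add0r ?addr0.
move: E; rewrite polE comp_polyD comp_polyC rmorphD pik M0 !mxE.
have -> : ((a == b)%:R : k)%:A = (a == b)%:R :> R.
  by case: (a == b); rewrite ?scale1r ?scale0r.
by rewrite -[RHS]add0r => /addIr.
Qed.

Lemma nmul_height : (forall t, Q t = 0) \/
  (forall j, ~~ (p %| j)%N -> Q j = 0) /\ Q p != 0.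
Proof.
have [H|] := pselect (forall i n, (0 < n)%N -> char_series i n = 0).
  by left; apply: constant_char_series.
move=> H; right.
have [i [n [n_gt0 sn]]] : exists i n, (0 < n)%N /\ char_series i n != 0.
  apply: contrapT => H'; apply: H => i n n_gt0; apply: contrapT => /eqP sn.
  by apply: H'; exists i, n.
have frob := char_series_frobenius i.
have ex : exists2 n, (0 < n)%N & char_series i n != 0 by exists n.
split; first exact: (frobenius_series_pth_power pk k_perfect ps_coef_nmul0 frob ex).
by have [] := frobenius_series_order pk ps_coef_nmul0 frob ex.
Qed.

End MatrixRepresentation.

(** * From the coefficients of [p]_F to the height *)

Lemma ps_coef_inj (k : fieldType) (f g : pseries k 1) :
  ps_coef f =1 ps_coef g -> f =1 g.
Proof. by move=> fg m; rewrite [m]mnm1_eq; apply: fg. Qed.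

(** To compare j-th coefficients, both series are evaluated at a generic X with X^q = 0 and j < q,
    where the claim becomes an identity f(X) = g(X^p) of polynomial values. *)
Lemma ps_comp_Xp (k : fieldType) (p : nat) (pk : p \in [pchar k]) (f : pseries k 1) :
  (forall j, ~~ (p %| j)%N -> ps_coef f j = 0) ->
  f =1 ps_comp (fun m : 'X_{1..1} => ps_coef f (p * m ord0))
         [tuple ps_of_mpoly ('X_ord0 ^+ (p ^ 1)%N)].
Proof.
move=> f0; have p_gt0 : (0 < p)%N by rewrite prime_gt0 ?(pcharf_prime pk).
set h := ps_comp _ _; apply: ps_coef_inj => j.
pose q := (p ^ j)%N.
have jq : (j < q)%N by apply: ltn_expp pk j.
have q_gt0 : (0 < q)%N by apply: leq_ltn_trans jq.
have [R [X [Xq free]]] := @monomials_free k q q_gt0.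
have tE (g : pseries k 1) i : tnth [tuple g] i = g by rewrite ord1.
have evalE :
    ps_eval q (ps_of_mpoly ('X_ord0 ^+ (p ^ 1)%N : {mpoly k[1]})) (fun=> X) = X ^+ p.
  by rewrite ps_eval_mpoly // rmorphXn /= mmapX mmap1U expn1.
apply: free jq; rewrite -!ps_eval1 // /h ps_eval_comp => [||//|]; last 2 first.
- move=> i; rewrite tE /ps_of_mpoly expn1.
  rewrite mcoeffXn; case: eqP => // /mnmP/(_ ord0).
  by rewrite mulmnE mnm1E eqxx mul1n mnm0E => p0; rewrite p0 in p_gt0.
- move=> i; rewrite tE evalE.
  by rewrite -exprM mulnC exprM Xq expr0n gtn_eqF.
have -> : (fun i : 'I_1 => ps_eval q (tnth [tuple ps_of_mpoly
    ('X_ord0 ^+ (p ^ 1)%N : {mpoly k[1]})] i) (fun=> X)) = fun=> X ^+ p.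
  by apply/funext => i; rewrite tE evalE.
have Xpq : (X ^+ p) ^+ q = 0 by rewrite -exprM mulnC exprM Xq expr0n gtn_eqF.
rewrite !ps_eval1 //.
pose P1 : {poly R} := \poly_(i < q) (ps_coef f (p * i))%:A.
(* The length q p is the one that matches P1(X^p); terms of index q and above vanish at X. *)
pose P2 : {poly R} := \poly_(i < q * p) (ps_coef f i)%:A.
have PE : P2 = P1 \Po 'X^p.
  apply/polyP => i; rewrite coef_comp_poly_Xn // !coef_poly.
  have [/dvdnP[l ->]|/f0->] := boolP (p %| i)%N; last by rewrite scale0r if_same.
  by rewrite mulnK // ltn_pmul2r // mulnC.
have := congr1 (fun P : {poly R} => P.[X]) PE.
rewrite horner_comp hornerXn (horner_nilp _ Xq) (horner_nilp _ Xpq) => E.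
transitivity (\sum_(n < q) P2`_n * X ^+ n).
  apply: eq_bigr => i _; rewrite coef_poly ifT ?mulr_algl //.
  by rewrite (leq_trans (ltn_ord i)) ?leq_pmulr.
rewrite E; apply: eq_bigr => i _.
rewrite coef_poly ltn_ord mulr_algl; congr (ps_coef f _ *: _).
by rewrite mulmnE mnm1E eqxx mul1n.
Qed.

(** Comparing coefficients of X^i Y^j in the identity of [representative_function] yields the
    finite-rank hypothesis of [finite_rank_representation] for the structure constants
    [fgl_pow F]. *)
Lemma matrix_representation (k : fieldType) (p : nat) (pk : p \in [pchar k])
    (F : formal_group_law k) (W : kscheme k) (G : kgroup k) (D : F_derivation pk F W) :
  linear_algebraic G -> aut_represented W G -> F_derivation_nontrivial D ->
  exists d (M : nat -> 'M[k]_d.+1),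
    [/\ M 0%N = 1%:M,
        forall i j, M i *m M j = \sum_(n < (i + j).+1) fgl_pow F n i j *: M n
      & exists2 n, (0 < n)%N & M n != 0].
Proof.
move=> [A [u [Au A_fin]]] WG D_neq.
have [phi [phi_nat phi_mul phi_incl phi_neq]] := derivation_hom WG D_neq.
have [L [lam [r [s [lam_neq lamE]]]]] :=
  representative_function Au phi_nat phi_incl A_fin phi_mul phi_neq.
have rank_lam i j :
    \sum_(n < (i + j).+1) fgl_pow F n i j * lam n = \sum_l r i l * s j l.
  pose e := (i + j)%N.
  have ijq : (i + j < p ^ e.+1)%N.
    by apply: ltn_trans (ltnSn _) _; apply: ltn_expp pk e.+1.
  set q := (p ^ e.+1)%N in ijq.
  have iq : (i < q)%N by apply: leq_ltn_trans ijq; rewrite leq_addr.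
  have jq : (j < q)%N by apply: leq_ltn_trans ijq; rewrite leq_addl.
  have [R [X [Y [Xq Yq free]]]] := bivariate_monomials_free k (q_gt0 pk e.+1).
  rewrite (c_wide (V := k^o) (fgl_pow_big F) lam ijq).
  apply: (free (fun i j => \sum_(n < q) fgl_pow F n i j * lam n)
    (fun i j => \sum_l r i l * s j l)) iq jq.
  transitivity (\sum_(n < q) lam n *: fgl_trunc p F e.+1 X Y ^+ n).
    transitivity (\sum_(n < q) \sum_(i < q) \sum_(j < q)
        (fgl_pow F n i j * lam n) *: (X ^+ i * Y ^+ j)).
      rewrite [RHS]exchange_big; apply: eq_bigr => i' _.
      by rewrite [RHS]exchange_big; apply: eq_bigr => j' _; rewrite scaler_suml.
    apply: eq_bigr => n _; rewrite (fgl_truncX pk) // scaler_sumr.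
    apply: eq_bigr => i' _; rewrite scaler_sumr; apply: eq_bigr => j' _.
    by rewrite scalerA mulrC.
  rewrite lamE //; transitivity (\sum_l \sum_(i < q) \sum_(j < q)
      (r i l * s j l) *: (X ^+ i * Y ^+ j)).
    apply: eq_bigr => l _; rewrite mulr_suml; apply: eq_bigr => i' _.
    rewrite mulr_sumr; apply: eq_bigr => j' _.
    by rewrite -scalerAl -scalerAr scalerA.
  rewrite exchange_big; apply: eq_bigr => i' _.
  by rewrite exchange_big; apply: eq_bigr => j' _; rewrite scaler_suml.
have [d [M [M0 MM [n n_gt0 Mn]]]] := finite_rank_representation (fgl_pow_big F)
  (fgl_pow_r0 pk F) (fgl_pow_0l pk F) (fgl_powA pk F) lam_neq rank_lam.
(* A nonzero M_n excludes size 0, so the matrices form a nonzero ring. *)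
case: d M M0 MM Mn => [|d] M M0 MM Mn; first by rewrite [M n]flatmx0 eqxx in Mn.
by exists d, M; split=> //; exists n.
Qed.

Theorem theorem3p2 (k : fieldType) (p : nat) (pk : p \in [pchar k])
    (k_perfect : forall x : k, exists y : k, y ^+ p = x)
    (F : formal_group_law k) (W : kscheme k)
    (W_aut : exists G : kgroup k, linear_algebraic G /\ aut_represented W G)
    (W_der : exists D : F_derivation pk F W, F_derivation_nontrivial D) :
  fgl_height p F (Some 1%N) \/ fgl_height p F None.
Proof.
have [G [G_lin WG]] := W_aut; have [D D_neq] := W_der.
have [d [M [M0 MM M_neq]]] := matrix_representation G_lin WG D_neq.
have [Q0|[Qpth Qp]] := nmul_height pk k_perfect M0 MM M_neq; [right|left].
  by apply: ps_coef_inj => j; rewrite Q0 /ps_coef /ps_of_mpoly mcoeff0.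
(* With g(X^p) = [p]_F(X), the linear coefficient of g is that of X^p in [p]_F, nonzero by [Qp]. *)
split=> //; exists (fun m : 'X_{1..1} => ps_coef (fgl_nmul F p) (p * m ord0)).
split; last exact: ps_comp_Xp pk _ Qpth.
  by rewrite mnm0E muln0 ps_coef_nmul0.
by rewrite mnm1E eqxx muln1.
Qed.
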